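(* Let $f(x)=\mathbb{E}_P[F(x;S)]$ with $\mathcal{X}\subset\mathbb{R}^n$ closed and convex and $\mathcal{X}^\star=\operatorname{argmin}_{x\in\mathcal{X}}f(x)$. Assume the problem of minimizing $f$ over $\mathcal{X}$ is an interpolation problem: there is $x^\star\in\mathcal{X}^\star$ such that $\inf_{x\in\mathcal{X}}F(x;s)=F(x^\star;s)$ for $P$-almost all $s$. Assume $\|\nabla f(x)-\nabla f(y)\|_2\le L\|x-y\|_2$ for $x,y\in\mathcal{X}$; that there is $\lambda>0$ with $f(x)-f(x^\star)\ge\lambda\operatorname{dist}(x,\mathcal{X}^\star)^2$ for all $x\in\mathcal{X}$; that there is $\sigma^2<\infty$ with $\mathbb{E}[\|f'(x)-F'(x;S)\|_2^2]\le\sigma^2\operatorname{dist}(x,\mathcal{X}^\star)^2$ for every $x\in\mathcal{X}$; and that $L\ge\lambda$. Let $m\ge1$ and let $\overline{F}_x(\cdot;s^{1:m})$ be any models of the average $\overline{F}(\cdot;s^{1:m})=\frac1m\sum_{j=1}^mF(\cdot;s^j)$ satisfying conditions (C.i) and (C.ii) stated in the context. Let $x_0\in\mathcal{X}$ and for $k\ge0$ $$x_{k+1}=\operatorname*{argmin}_{x\in\mathcal{X}}\Big\{\overline{F}_{x_k}(x;S_k^{1:m})+\frac{1}{2\alpha_k}\|x-x_k\|_2^2\Big\},$$ with $S_k^j$ i.i.d. from $P$. Then for every $k\ge 1$: (i) If $\alpha_i=\frac{1}{L+\eta_i}$ with $\eta_i\ge0$ for all $i$, then $$\mathbb{E}[\operatorname{dist}(x_k,\mathcal{X}^\star)^2]\le\exp\Big(-\frac12\sum_{i=0}^{k-1}\lambda\alpha_i+\sum_{i=0}^{k-1}\frac{\sigma^2}{m}\frac{\alpha_i}{\eta_i}\Big)\operatorname{dist}(x_0,\mathcal{X}^\star)^2,$$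 where a term with $\eta_i=0$ is interpreted as $+\infty$. (ii) If $\alpha_i=(L+\eta)^{-1}$ for all $i$ with $\eta=\max\{L,\frac{8\sigma^2}{m\lambda}\}$, then $$\mathbb{E}[\operatorname{dist}(x_k,\mathcal{X}^\star)^2]\le\exp\Big(-k\min\Big\{\frac{\lambda}{8L},\frac{m\lambda^2}{64\sigma^2}\Big\}\Big)\mathbb{E}[\operatorname{dist}(x_0,\mathcal{X}^\star)^2].$$
   Context: Problem: $P$ is a probability distribution on a sample space $\mathcal{S}$; for each $s\in\mathcal{S}$, $F(\cdot;s):\mathbb{R}^n\to\mathbb{R}\cup\{+\infty\}$ is closed convex and subdifferentiable on the closed convex set $\mathcal{X}$; $F(x;\cdot)$ is measurable and $P$-integrable for $x\in\mathcal{X}$. $F'(x;s)$ denotes an arbitrary (measurable in $s$) element of $\partial F(x;s)$, with $\mathbb{E}[F'(x;S)]=f'(x)$, and $f'(x)=\nabla f(x)$ here; the bound on $\mathbb{E}[\|f'(x)-F'(x;S)\|_2^2]$ is assumed for every such choice. $\operatorname{dist}$ is Euclidean distance. The starting point $x_0$ is deterministic in (i), and in (ii) may be random, independent of the samples. If $\sigma=0$, $\frac{m\lambda^2}{64\sigma^2}$ is read as $+\infty$. Models of the average: for each $x\in\mathcal{X}$ and $s^{1:m}=(s^1,\ldots,s^m)\in\mathcal{S}^m$ there is a function $\overline{F}_x(\cdot;s^{1:m})$ such that: (C.i) $y\mapsto\overline{F}_x(y;s^{1:m})$ is convex and subdifferentiable on $\mathcal{X}$; (C.ii) $\overline{F}_x(y;s^{1:m})\le\overline{F}(y;s^{1:m})$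 for all $y\in\mathcal{X}$, and $\overline{F}_x(x;s^{1:m})=\overline{F}(x;s^{1:m})$. It is understood (as a consequence of (C.ii)) that $\partial\overline{F}_x(y;s^{1:m})|_{y=x}\subset\partial\overline{F}(x;s^{1:m})$, and subgradients of $\overline F(\cdot;s^{1:m})$ at $x$ are averages $\frac1m\sum_jF'(x;s^j)$. Measurability and existence of the iterates are assumed. *)

(* Defs.v *)
From HB Require Import structures.
From mathcomp Require Import all_boot all_order all_algebra finmap.
From mathcomp Require Import all_classical all_reals all_analysis.

Set Implicit Arguments.
Unset Strict Implicit.
Unset Printing Implicit Defensive.

Import Order.TTheory GRing.Theory Num.Theory.
Import numFieldNormedType.Exports.

Local Open Scope classical_set_scope.
Local Open Scope ring_scope.

(* The library norm on 'rV[R]_n is the sup norm, hence dot and enorm. *)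
Definition dot (R : realType) (n : nat) (u v : 'rV[R]_n) : R :=
  \sum_(i < n) u 0 i * v 0 i.

Definition enorm (R : realType) (n : nat) (u : 'rV[R]_n) : R :=
  Num.sqrt (dot u u).

(* Meant for nonempty A only: the real-valued inf of the empty set is 0. *)
Definition dist (R : realType) (n : nat) (x : 'rV[R]_n) (A : set 'rV[R]_n) : R :=
  inf [set enorm (x - y) | y in A].

Definition argmin (T : Type) (R : realType) (A : set T) (h : T -> \bar R) :
    set T :=
  [set x | A x /\ forall y, A y -> (h x <= h y)%E].

Definition convex_on (R : realType) (n : nat) (D : set 'rV[R]_n)
    (h : 'rV[R]_n -> \bar R) :=
  forall (x y : 'rV[R]_n) (t : R), D x -> D y -> 0 <= t <= 1 ->
    (h (t *: x + (1 - t) *: y)%R <= t%:E * h x + (1 - t)%:E * h y)%E.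

Definition closed_function (R : realType) (n : nat) (h : 'rV[R]_n -> \bar R) :=
  closed [set p : 'rV[R]_n * R | (h p.1 <= p.2%:E)%E].

(* The subgradient inequality ranges over all of R^n, not only over the
   constraint set; the subdifferential is empty where h is infinite. *)
Definition subdiff (R : realType) (n : nat) (h : 'rV[R]_n -> \bar R)
    (x : 'rV[R]_n) : set 'rV[R]_n :=
  [set g | h x \is a fin_num /\
           forall y, (h x + (dot g (y - x)%R)%:E <= h y)%E].

Definition subdifferentiable_on (R : realType) (n : nat) (D : set 'rV[R]_n)
    (h : 'rV[R]_n -> \bar R) :=
  forall x, D x -> subdiff h x !=set0.

(* First-order expansion of h along D.  At interior points of D this is the
   Frechet gradient; only the values of h on D matter. *)
Definition is_gradient_on (R : realType) (n : nat) (D : set 'rV[R]_n)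
    (h : 'rV[R]_n -> R) (x g : 'rV[R]_n) :=
  forall e : R, 0 < e ->
    \forall y \near within D (nbhs x),
      `|h y - h x - dot g (y - x)| <= e * enorm (y - x).

(* Borel sigma-algebra of R^n, generated by the coordinate projections. *)
Section measurable_rV.
Context {R : realType} (n : nat).

Let coord : 'I_n -> 'rV[R]_n -> R := fun i x => x 0 i.

Let rV_set0 : g_sigma_preimage coord set0.
Proof. exact: sigma_algebra0. Qed.

Let rV_setC A : g_sigma_preimage coord A -> g_sigma_preimage coord (~` A).
Proof. exact: sigma_algebraC. Qed.

Let rV_bigcup (F : (set 'rV[R]_n)^nat) :
  (forall i, g_sigma_preimage coord (F i)) ->
  g_sigma_preimage coord (\bigcup_i (F i)).
Proof. exact: sigma_algebra_bigcup. Qed.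

HB.instance Definition _ := @isMeasurable.Build default_measure_display
  'rV[R]_n (g_sigma_preimage coord) rV_set0 rV_setC rV_bigcup.

End measurable_rV.

Section power_measure.
Context {d : measure_display} {S : measurableType d} {R : realType}.

Definition tcons (m : nat) (p : S * m.-tuple S) : m.+1.-tuple S :=
  [tuple of p.1 :: p.2].

Lemma measurable_tcons (m : nat) : measurable_fun setT (@tcons m).
Proof. exact: measurable_cons. Qed.

HB.instance Definition _ (m : nat) :=
  isMeasurableFun.Build _ _ _ _ (@tcons m) (@measurable_tcons m).

(* The m-fold product P^m on S^m. *)
Fixpoint power_measure (P : probability S R) (m : nat) :
    probability (m.-tuple S) R :=
  match m with
  | 0%N => dirac [tuple]
  | k.+1 => distribution (P \x power_measure P k)%E (@tcons k)
  end.

End power_measure.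

Definition mutually_independent (d : measure_display) (T : measurableType d)
    (R : realType) (P : probability T R) (I : choiceType)
    (G : I -> set (set T)) :=
  forall (J : {fset I}) (A : I -> set T), (forall i, i \in J -> G i (A i)) ->
    P (\bigcap_(i in [set` J]) A i) = (\prod_(i <- J) P (A i))%E.

Section stochastic_problem.
Context {R : realType} {n : nat} {d : measure_display} {S : measurableType d}.
Implicit Types (P : probability S R) (F : 'rV[R]_n -> S -> \bar R)
  (X : set 'rV[R]_n).

Definition objective P F (x : 'rV[R]_n) : \bar R := (\int[P]_s F x s)%E.

(* G is an admissible choice of s |-> F'(x; s). *)
Definition subgradient_selection F (x : 'rV[R]_n) (G : S -> 'rV[R]_n) :=
  measurable_fun setT G /\ forall s, subdiff (F^~ s) x (G s).

Definition sample_average F (m : nat) (s : m.-tuple S) (x : 'rV[R]_n) : \bar R :=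
  ((m%:R^-1)%:E * \sum_(j < m) F x (tnth s j))%E.

Definition prox_objective (m : nat)
    (Fm : 'rV[R]_n -> m.-tuple S -> 'rV[R]_n -> \bar R)
    (a : R) (x : 'rV[R]_n) (s : m.-tuple S) (y : 'rV[R]_n) : \bar R :=
  (Fm x s y + ((2 * a)^-1 * enorm (y - x) ^+ 2)%:E)%E.

(* Existence and joint measurability of the proximal update with stepsize a. *)
Definition measurable_prox X (m : nat)
    (Fm : 'rV[R]_n -> m.-tuple S -> 'rV[R]_n -> \bar R) (a : R) :=
  exists T : 'rV[R]_n * m.-tuple S -> 'rV[R]_n,
    measurable_fun (X `*` setT) T /\
    forall x s, X x -> argmin X (prox_objective Fm a x s) (T (x, s)).

Definition minibatch (T : Type) (m : nat) (xi : nat -> 'I_m -> T -> S)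
    (k : nat) (w : T) : m.-tuple S := [tuple xi k j w | j < m].

Definition iid_samples (d' : measure_display) (T : measurableType d')
    (Pr : probability T R) P (m : nat) (xi : nat -> 'I_m -> T -> S) :=
  [/\ forall k j, measurable_fun setT (xi k j),
      forall k j A, measurable A -> Pr (xi k j @^-1` A) = P A
    & mutually_independent Pr
        (fun kj : nat * 'I_m => g_sigma_algebra_preimage (xi kj.1 kj.2))].

(* None is the index of the initial point. *)
Definition start_independent (d' : measure_display) (T : measurableType d')
    (Pr : probability T R) (m : nat) (x0 : T -> 'rV[R]_n)
    (xi : nat -> 'I_m -> T -> S) :=
  mutually_independent Pr (fun o : option (nat * 'I_m) =>
    if o is Some kj then g_sigma_algebra_preimage (xi kj.1 kj.2)
    else g_sigma_algebra_preimage x0).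

Definition prox_iterates (T : Type) X (m : nat)
    (Fm : 'rV[R]_n -> m.-tuple S -> 'rV[R]_n -> \bar R)
    (alpha : nat -> R) (xi : nat -> 'I_m -> T -> S) (x : nat -> T -> 'rV[R]_n) :=
  forall k w,
    argmin X (prox_objective Fm (alpha k) (x k w) (minibatch xi k w)) (x k.+1 w).

End stochastic_problem.

(* Main.v *)
Require Import Defs.
From HB Require Import structures.
From mathcomp Require Import all_boot all_order all_algebra finmap.
From mathcomp Require Import ring lra.
From mathcomp Require Import all_classical all_reals all_analysis measurable_realfun.

Set Implicit Arguments.
Unset Strict Implicit.
Unset Printing Implicit Defensive.

Import Order.TTheory GRing.Theory Num.Theory.
Import numFieldNormedType.Exports.

Local Open Scope classical_set_scope.
Local Open Scope ring_scope.

(* Write [D] for the distance to the solution set, [T] for the proximal update of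
   [x], [e] for the difference between the gradient at [x] and the sampled
   subgradient, and [y] for a solution.  Strong convexity of the proximal
   objective at its minimizer, the model lower bound through its subgradient at
   [x], and the descent lemma for [f] combine, with [alpha^-1 = L + eta], into
     ((L + eta) / 2 + lambda) D(T)^2 <= (L + eta) / 2 |x - y|^2
        + (Fbar(y) - Fbar(x)) + (f(x) - f(y)) + |e|^2 / (2 eta),
   where [- lambda D(T)^2] is the growth condition at [T].  In expectation the two
   differences cancel and [|e|^2] is at most [sigma^2 D(x)^2 / m], which gives the
   contraction factor
     (1 + sigma^2 alpha / (m eta)) / (1 + 2 lambda alpha)
       <= exp (- lambda alpha / 2 + sigma^2 alpha / (m eta)).
   The current iterate is independent of the next minibatch, so the factors
   multiply. *)

(** * Borel sets and distances in Euclidean space *)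

Section rV_measurability.
Context {R : realType} {n : nat}.
Implicit Types (A U X : set 'rV[R]_n) (x y u : 'rV[R]_n).

Lemma measurable_coord (i : 'I_n) :
  measurable_fun setT (fun x : 'rV[R]_n => x 0 i).
Proof.
move=> _ Y mY; rewrite setTI; apply: sub_sigma_algebra => /=.
rewrite -bigcup_seq/=; exists i => /=; first by rewrite mem_index_enum.
by exists Y => //; rewrite setTI.
Qed.

(** An open set is the union of the boxes with rational endpoints that it contains. There are
    countably many such boxes, and each is a finite intersection of preimages of intervals under
    coordinates. *)
Lemma open_measurable_rV U : open U -> measurable U.
Proof.
move=> oU.
pose box (q : {ffun 'I_n -> rat * rat}) : set 'rV[R]_n :=
  [set x | forall i, ratr (q i).1 < x 0 i < ratr (q i).2].
have mbox q : measurable (box q).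
  rewrite (_ : box q = \bigcap_i
      ((fun x : 'rV[R]_n => x 0 i) @^-1` `]ratr (q i).1, ratr (q i).2[)).
    apply: fin_bigcap_measurable => // i _.
    rewrite -[X in measurable X]setTI; exact: measurable_coord.
  apply/seteqP; split => x /= h i; first by move=> _; rewrite /= in_itv/= h.
  by have := h i I; rewrite /= in_itv.
rewrite (_ : U = \bigcup_q (if `[< box q `<=` U >] then box q else set0)).
  apply: countable_bigcupT_measurable => [|q]; first exact: countableP.
  by case: ifP => // _; exact: measurable0.
apply/seteqP; split => [x Ux|x [q _]]; last by case: asboolP => // + ?; exact.
have [P Px PU] : nbhs x U by apply: open_nbhs_nbhs.
have /choice[q qP] : forall i, exists p : rat * rat,
    ratr p.1 < x 0 i < ratr p.2 /\ `]ratr p.1, ratr p.2[ `<=` P 0 i.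
  move=> i; have /nbhs_ballP[e /= e0 eP] := Px 0 i.
  have /rat_in_itvoo[a] : x 0 i - e < x 0 i by rewrite gtrDl oppr_lt0.
  have /rat_in_itvoo[b] : x 0 i < x 0 i + e by rewrite ltrDl.
  rewrite !in_itv/= => /andP[b1 b2] /andP[a1 a2]; exists (a, b) => /=.
  split; first by rewrite a2 b1.
  move=> z /=; rewrite in_itv/= => /andP[z1 z2]; apply: eP.
  by rewrite /ball/= distrC ltr_distl; apply/andP; split; lra.
exists [ffun i => q i] => //; case: asboolP => [_ i|]; first by rewrite ffunE; exact: (qP i).1.
case=> y yq; apply: PU => i j; rewrite (ord1 i).
by apply: (qP j).2 => /=; rewrite in_itv/=; have := yq j; rewrite ffunE.
Qed.

Lemma closed_measurable_rV A : closed A -> measurable A.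
Proof.
move=> cA; rewrite -(setCK A); apply: measurableC.
by apply: open_measurable_rV; exact: closed_openC.
Qed.

Lemma measurable_dot d (T : measurableType d) (f g : T -> 'rV[R]_n) :
  measurable_fun setT f -> measurable_fun setT g ->
  measurable_fun setT (fun t => dot (f t) (g t)).
Proof.
move=> mf mg; apply: measurable_sum => i.
by apply: measurable_funM; exact: (measurableT_comp (measurable_coord i)).
Qed.

Lemma measurable_enorm d (T : measurableType d) (f : T -> 'rV[R]_n) :
  measurable_fun setT f -> measurable_fun setT (fun t => enorm (f t)).
Proof.
move=> mf; rewrite -[X in measurable_fun _ X]/(Num.sqrt \o (fun t => dot (f t) (f t))).
apply: measurableT_comp; last exact: measurable_dot.
apply: continuous_measurable_fun; exact: sqrt_continuous.
Qed.

Lemma measurable_rVP d (T : measurableType d) (f : T -> 'rV[R]_n) :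
  (forall i, measurable_fun setT (fun t => f t 0 i)) -> measurable_fun setT f.
Proof.
move=> mf.
pose coord : 'I_n -> 'rV[R]_n -> R := fun i x => x 0 i.
suff : g_sigma_preimage (fun i => coord i \o f) `<=` measurable.
  rewrite g_sigma_preimage_comp => h _ Y mY.
  by apply: h; exists Y.
apply: smallest_sub; first exact: sigma_algebra_measurable.
rewrite -bigcup_seq; apply: bigcup_sub => i _ _ [B mB <-].
exact: mf.
Qed.

Lemma measurable_rV_sub d (T : measurableType d) (f : T -> 'rV[R]_n) x :
  measurable_fun setT f -> measurable_fun setT (fun t => f t - x).
Proof.
move=> mf; apply: measurable_rVP => i.
rewrite (_ : (fun t => _) = (fun t => f t 0 i - x 0 i)); last by apply/funext => t; rewrite !mxE.
apply: measurable_funB => //; exact: (measurableT_comp (measurable_coord i)).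
Qed.

Lemma continuous_enorm y : continuous (fun x => enorm (x - y)).
Proof.
(* Summing over an arbitrary list of indices allows an induction on the list. *)
pose S (s : seq 'I_n) (x : 'rV[R]_n) : R := \sum_(i <- s) (x - y) 0 i * (x - y) 0 i.
suff Sc s : continuous (S s).
  move=> x; apply: (continuous_comp (f := S (index_enum 'I_n))); first exact: Sc.
  exact: sqrt_continuous.
elim: s => [|i s IHs].
  have -> : S [::] = cst 0 by apply/funext => x; rewrite /S big_nil.
  exact: cst_continuous.
have -> : S (i :: s) = (fun x => (x 0 i - y 0 i) * (x 0 i - y 0 i) + S s x).
  by apply/funext => x; rewrite /S big_cons !mxE.
move=> x; have FF : Filter (nbhs x).
  exact: (@nbhs_filter ('rV[R]_n : topologicalType) x).
apply: cvgD; last exact: IHs.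
have ci : (fun z : 'rV[R]_n => z 0 i - y 0 i) @ x --> x 0 i - y 0 i.
  apply: cvgB; last exact: (@cst_continuous _ _ (y 0 i)  x).
  exact: (@coord_continuous R 1 n 0 i x).
exact: cvgM.
Qed.

Lemma dist_le A x y : A y -> dist x A <= enorm (x - y).
Proof.
move=> Ay; apply: ge_inf; last by exists y.
by exists 0 => _ [z _ <-]; exact: sqrtr_ge0.
Qed.

Lemma dist_ge0 A x : 0 <= dist x A.
Proof.
have [->|/set0P[y Ay]] := eqVneq A set0; first by rewrite /dist image_set0 inf0.
by apply: lb_le_inf => [|_ [z _ <-]]; [exists (enorm (x - y)), y|exact: sqrtr_ge0].
Qed.

Lemma dist_approx A x e : A !=set0 -> 0 < e ->
  exists2 y, A y & enorm (x - y) < dist x A + e.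
Proof.
move=> [a Aa] e0; have [] := @inf_adherent _ [set enorm (x - y) | y in A] e e0.
  split; first by exists (enorm (x - a)), a.
  by exists 0 => _ [z _ <-]; exact: sqrtr_ge0.
by move=> _ [y Ay <-] ?; exists y.
Qed.

(** The set where the distance is below [r] is a union of open Euclidean balls centred in [A]. The
    union may be uncountable, so measurability is obtained from openness. *)
Lemma measurable_dist A : A !=set0 -> measurable_fun setT (fun x => dist x A).
Proof.
move=> A0 mT; apply: (measurability _ (RGenInftyO.measurableE R)) => // _ [_ [r ->] <-].
rewrite setTI; apply: open_measurable_rV.
rewrite (_ : _ @^-1` _ = \bigcup_(y in A) [set x | enorm (x - y) < r]).
  apply: bigcup_open => y _.
  apply: (@open_comp _ _ (fun x => enorm (x - y)) [set z | z < r]); last exact: open_lt.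
  by move=> x _; exact: continuous_enorm.
apply/seteqP; split => [x|x [y Ay]] /=; rewrite in_itv/=.
  move=> xr; have [|y Ay yr] := @dist_approx A x (r - dist x A) A0; first lra.
  by exists y => //=; lra.
by apply: le_lt_trans; exact: dist_le.
Qed.

End rV_measurability.

(** * Euclidean inner product, norm and elementary inequalities *)

Section euclidean.
Context {R : realType} {n : nat}.
Implicit Types (u v w x y : 'rV[R]_n) (a b : R).

Lemma dotC u v : dot u v = dot v u.
Proof. by apply: eq_bigr => i _; rewrite mulrC. Qed.

Lemma dotDl u v w : dot (u + v) w = dot u w + dot v w.
Proof. by rewrite -big_split; apply: eq_bigr => i _; rewrite mxE mulrDl. Qed.

Lemma dotZl a u w : dot (a *: u) w = a * dot u w.
Proof. by rewrite mulr_sumr; apply: eq_bigr => i _; rewrite mxE mulrA. Qed.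

Lemma dotNl u w : dot (- u) w = - dot u w.
Proof. by rewrite -scaleN1r dotZl mulN1r. Qed.

Lemma dotDr u v w : dot w (u + v) = dot w u + dot w v.
Proof. by rewrite !(dotC w) dotDl. Qed.

Lemma dotZr a u w : dot w (a *: u) = a * dot w u.
Proof. by rewrite !(dotC w) dotZl. Qed.

Lemma dotNr u w : dot w (- u) = - dot w u.
Proof. by rewrite !(dotC w) dotNl. Qed.

Definition dotE := (dotDl, dotDr, dotNl, dotNr, dotZl, dotZr).

Lemma dot_ge0 u : 0 <= dot u u.
Proof. by apply: sumr_ge0 => i _; rewrite -expr2 sqr_ge0. Qed.

Lemma dot0 u : dot 0 u = 0.
Proof. by rewrite -(scale0r u) dotZl mul0r. Qed.

Lemma enorm_ge0 u : 0 <= enorm u.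
Proof. exact: sqrtr_ge0. Qed.

Lemma sqr_enorm u : enorm u ^+ 2 = dot u u.
Proof. by rewrite sqr_sqrtr// dot_ge0. Qed.

Lemma sqr_enormZ a u : enorm (a *: u) ^+ 2 = a ^+ 2 * enorm u ^+ 2.
Proof. by rewrite !sqr_enorm !dotE mulrA expr2. Qed.

Lemma sqr_enormD u v :
  enorm (u + v) ^+ 2 = enorm u ^+ 2 + 2 * dot u v + enorm v ^+ 2.
Proof. by rewrite !sqr_enorm !dotE (dotC v u); ring. Qed.

Lemma enormN u : enorm (- u) = enorm u.
Proof. by rewrite /enorm !dotE opprK. Qed.

Lemma enorm_eq0 u : enorm u = 0 -> u = 0.
Proof.
move=> u0; have : dot u u = 0 by rewrite -sqr_enorm u0 expr0n.
move/eqP; rewrite psumr_eq0 => [/allP h|i _]; last by rewrite -expr2 sqr_ge0.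
apply/rowP => i; rewrite mxE; apply/eqP.
by have := h i (mem_index_enum i); rewrite mulf_eq0 orbb.
Qed.

Lemma cauchy_schwarz u v : dot u v <= enorm u * enorm v.
Proof.
have [v0|v0] := eqVneq (enorm v) 0.
  by rewrite v0 (enorm_eq0 v0) dotC dot0 mulr0.
have vp : 0 < enorm v by rewrite lt0r v0 enorm_ge0.
(* Expanded, this square reads [2 |u|^2 |v|^2 - 2 |u| |v| dot u v >= 0], to be divided by [|u| |v|]
   once both norms are known to be positive. *)
have h := dot_ge0 (enorm v *: u - enorm u *: v).
have [u0|u0] := eqVneq (enorm u) 0.
  by rewrite u0 (enorm_eq0 u0) dot0 mul0r.
have up : 0 < enorm u by rewrite lt0r u0 enorm_ge0.
have uv : 0 < enorm u * enorm v by rewrite mulr_gt0.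
move: h; rewrite !dotE -!sqr_enorm (dotC v u) => h.
rewrite -(ler_pM2l uv) -subr_ge0; nra.
Qed.

Lemma dot_young u v a : 0 < a ->
  dot u v <= a / 2 * enorm v ^+ 2 + (2 * a)^-1 * enorm u ^+ 2.
Proof.
move=> a0; have h := dot_ge0 (u - a *: v).
rewrite -subr_ge0.
have -> : a / 2 * enorm v ^+ 2 + (2 * a)^-1 * enorm u ^+ 2 - dot u v =
   (2 * a)^-1 * dot (u - a *: v) (u - a *: v).
  rewrite !sqr_enorm !dotE (dotC v u); field; exact: lt0r_neq0.
by rewrite mulr_ge0// invr_ge0 mulr_ge0// ltW.
Qed.

(** The subtracted term is the exact strong convexity of the squared distance; it produces the gain
    [c |y - p|^2] of the proximal step. *)
Lemma sqr_enorm_convex (t : R) x y z :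
  enorm (t *: y + (1 - t) *: z - x) ^+ 2 =
  t * enorm (y - x) ^+ 2 + (1 - t) * enorm (z - x) ^+ 2
    - t * (1 - t) * enorm (y - z) ^+ 2.
Proof.
rewrite !sqr_enorm !dotE (dotC z y) (dotC x y) (dotC x z); ring.
Qed.

End euclidean.
(** * Proximal step and descent lemma *)

Lemma convex_setP (R : realType) (n : nat) (X : set 'rV[R]_n) (x y : 'rV[R]_n) (t : R) :
  convex_set X -> X x -> X y -> 0 <= t <= 1 -> X (t *: x + (1 - t) *: y).
Proof.
move=> cX Xx Xy /andP[t0 t1]; have := cX x y (Itv01 t0 t1).
by rewrite !inE; apply.
Qed.

(** Algebraic form of letting [t] tend to 0. It serves for the strong convexity argument and for
    replacing a nearly closest solution by the distance itself. *)
Lemma le_linear_limit (R : realFieldType) (a b c : R) :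
  (forall t, 0 < t <= 1 -> a <= b + t * c) -> a <= b.
Proof.
move=> h; have [c0|c0] := leP c 0.
  by have := h 1; rewrite ltr01 lexx => /(_ isT); lra.
apply/ler_addgt0Pr => e e0.
have m0 : 0 < Num.min 1 (e / c) by rewrite lt_min ltr01 divr_gt0.
apply: (le_trans (h (Num.min 1 (e / c)) _)); first by rewrite m0 ge_min lexx.
by rewrite lerD2l -ler_pdivlMr// ge_min lexx orbT.
Qed.

Section proximal_step.
Context {R : realType} {n : nat}.
Variables (X : set 'rV[R]_n) (h : 'rV[R]_n -> \bar R) (x : 'rV[R]_n) (c : R).
Hypotheses (cX : convex_set X) (ch : convex_on X h).
Hypothesis (hfin : forall y, X y -> h y \is a fin_num).
Let obj y := (h y + (c * enorm (y - x) ^+ 2)%:E)%E.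

(** Compare the minimizer [p] with [t y + (1 - t) p]. Convexity of [h] and the exact expansion of
    the square leave, after division by [t], the claim with an error [t c |y - p|^2], which vanishes
    as [t] tends to 0. *)
Lemma prox_three_point (p y : 'rV[R]_n) : 0 <= c -> argmin X obj p -> X y ->
  fine (h p) + c * enorm (p - x) ^+ 2 + c * enorm (y - p) ^+ 2
    <= fine (h y) + c * enorm (y - x) ^+ 2.
Proof.
move=> c0 [Xp pmin] Xy.
apply: (@le_linear_limit _ _ _ (c * enorm (y - p) ^+ 2)) => t /andP[t0 t1].
have t01 : 0 <= t <= 1 by rewrite ltW.
have Xz := convex_setP cX Xy Xp t01.
have := pmin _ Xz; rewrite /obj.
have := ch Xy Xp t01.
rewrite -(fineK (hfin Xz)) -(fineK (hfin Xy)) -(fineK (hfin Xp)).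
rewrite -!EFinM -!EFinD !lee_fin sqr_enorm_convex => h1 h2.
rewrite -(ler_pM2l t0) -subr_ge0; nra.
Qed.

(** Adding the three-point inequalities at [p] and at [q] gives [2 c |p - q|^2 <= 0]. Uniqueness
    later identifies the iterates with a measurable update map. *)
Lemma prox_unique (p q : 'rV[R]_n) : 0 < c -> argmin X obj p -> argmin X obj q ->
  p = q.
Proof.
move=> c0 pm qm; have h1 := prox_three_point (ltW c0) pm qm.1.
have h2 := prox_three_point (ltW c0) qm pm.1.
have e0 : enorm (q - p) = enorm (p - q) by rewrite -enormN opprB.
have : c * enorm (p - q) ^+ 2 <= 0 by rewrite e0 in h1; lra.
rewrite pmulr_rle0// => e1; apply/eqP; rewrite -subr_eq0; apply/eqP/enorm_eq0.
by apply/eqP; rewrite -sqrf_eq0 eq_le e1 sqr_ge0.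
Qed.

End proximal_step.

(* An estimate with constant [C] improves to [L / 4 + C / 2] when it is applied
   on both halves of the segment; the fixed point is [L / 2]. *)
Lemma descent_lemma (R : realType) (n : nat) (X : set 'rV[R]_n)
    (f : 'rV[R]_n -> R) (gf : 'rV[R]_n -> 'rV[R]_n) (L : R) :
  convex_set X ->
  (forall x y, X x -> X y -> f x + dot (gf x) (y - x) <= f y) ->
  (forall x y, X x -> X y -> enorm (gf x - gf y) <= L * enorm (x - y)) ->
  forall x y, X x -> X y ->
    f y <= f x + dot (gf x) (y - x) + L / 2 * enorm (y - x) ^+ 2.
Proof.
move=> cX sub lip.
have dlip x y : X x -> X y -> dot (gf y - gf x) (y - x) <= L * enorm (y - x) ^+ 2.
  move=> Xx Xy; apply: (le_trans (cauchy_schwarz _ _)).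
  by rewrite expr2 mulrA ler_wpM2r ?enorm_ge0// lip.
pose C k : R := L / 2 + 2^-1 ^+ k * (L / 2).
have bound k x y : X x -> X y ->
    f y <= f x + dot (gf x) (y - x) + C k * enorm (y - x) ^+ 2.
  elim: k x y => [|k IHk] x y Xx Xy.
    (* Here [C 0 = L]: the subgradient inequality at [y] bounds [f y] with the gradient at [y],
       which is then exchanged for the one at [x] at the cost [L |y - x|^2]. *)
    have := dlip x y Xx Xy; have := sub y x Xy Xx.
    by rewrite /C expr0 !dotE; lra.
  pose z := 2^-1 *: y + (1 - 2^-1) *: x.
  have Xz : X z by apply: convex_setP => //; apply/andP; split; lra.
  have zx : z - x = 2^-1 *: (y - x) by apply/rowP => i; rewrite !mxE; field.
  have yz : y - z = 2^-1 *: (y - x) by apply/rowP => i; rewrite !mxE; field.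
  have := dlip x z Xx Xz; have := IHk z y Xz Xy; have := IHk x z Xx Xz.
  rewrite zx yz sqr_enormZ !dotZr dotDl dotNl /C (exprS _ k).
  move: (2^-1 ^+ k) (enorm (y - x)) => q r; lra.
move=> x y Xx Xy; apply/ler_addgt0Pr => e e0.
pose M := L / 2 * enorm (y - x) ^+ 2.
(* The excess over the target is [M / 2^k], and [2^k > k > M / e] makes it smaller than [e]. *)
have [k kM] : exists k : nat, M / e < k%:R.
  by exists (Num.truncn (M / e)).+1; exact: truncnS_gt.
apply: (le_trans (bound k x y Xx Xy)).
rewrite /C mulrDl addrA lerD2l -mulrA -/M exprVn ler_pdivrMl ?exprn_gt0//.
rewrite -ler_pdivrMr//; apply: (le_trans (ltW kM)).
by rewrite -natrX ler_nat ltnW// ltn_expl.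
Qed.

(** * Integration over minibatches *)

Section has_integral.
Context {d : measure_display} {T : measurableType d} {R : realType}.
Variable P : probability T R.
Implicit Types (f g : T -> R) (a b k : R).

(** Integrability is bundled with a real value, so that linear combinations of integrals are
    computed in [R] and no difference of infinities can occur. *)
Definition has_integral f a :=
  P.-integrable setT (EFin \o f) /\ (\int[P]_x (f x)%:E = a%:E)%E.

Lemma has_integral_measurable f a : has_integral f a -> measurable_fun setT f.
Proof. by move=> [/measurable_int/measurable_EFinP]. Qed.

Lemma has_integralD f g a b : has_integral f a -> has_integral g b ->
  has_integral (fun x => f x + g x) (a + b).
Proof.
move=> [fi fa] [gi gb]; split; first exact: (integrableD measurableT fi gi).
under eq_integral do rewrite EFinD.
by rewrite (integralD measurableT fi gi) fa gb.
Qed.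

Lemma has_integralZ k f a : has_integral f a ->
  has_integral (fun x => k * f x) (k * a).
Proof.
move=> [fi fa]; split; first exact: (integrableZl measurableT k fi).
under eq_integral do rewrite EFinM.
by rewrite (integralZl measurableT fi) fa.
Qed.

Lemma has_integral_cst k : has_integral (fun=> k) k.
Proof.
split; first exact: (finite_measure_integrable_cst P k measurableT).
by rewrite integral_cst//= probability_setT mule1.
Qed.

Lemma has_integral_sum (I : Type) (s : seq I) (f : I -> T -> R) (a : I -> R) :
  (forall i, has_integral (f i) (a i)) ->
  has_integral (fun x => \sum_(i <- s) f i x) (\sum_(i <- s) a i).
Proof.
move=> fa; elim: s => [|i s IHs].
  under eq_fun do rewrite big_nil; rewrite big_nil; exact: has_integral_cst.
under eq_fun do rewrite big_cons; rewrite big_cons; exact: has_integralD.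
Qed.

Lemma has_integral_dot n (H : T -> 'rV[R]_n) (h c : 'rV[R]_n) :
  (forall i, has_integral (fun x => H x 0 i) (h 0 i)) ->
  has_integral (fun x => dot (H x) c) (dot h c).
Proof.
move=> Hh; apply: has_integral_sum => i.
under eq_fun do rewrite mulrC; rewrite mulrC; exact: has_integralZ.
Qed.

Lemma has_integral_le f g a b : has_integral f a -> has_integral g b ->
  (forall x, f x <= g x) -> a <= b.
Proof.
move=> [fi fa] [gi gb] fg; rewrite -lee_fin -fa -gb.
by apply: le_integral => // x _; rewrite lee_fin.
Qed.

(** A finite value of the integral forces both the positive and the negative part to have finite
    integrals. Hence an equation for an expectation already carries integrability. *)
Lemma has_integral_fin f a : measurable_fun setT f ->
  (\int[P]_x (f x)%:E = a%:E)%E -> has_integral f a.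
Proof.
move=> mf fa; split=> //; apply/integrableP; split; first exact/measurable_EFinP.
by rewrite (integral_fin_num_abs P measurableT mf) fa.
Qed.

Lemma has_integral_ge0 f b : measurable_fun setT f -> (forall x, 0 <= f x) ->
  (\int[P]_x (f x)%:E <= b%:E)%E -> exists2 a, has_integral f a & a <= b.
Proof.
move=> mf f0 fb.
have ifin : (\int[P]_x (f x)%:E)%E \is a fin_num.
  rewrite ge0_fin_numE; first exact: le_lt_trans fb (ltry _).
  by apply: integral_ge0 => x _; rewrite lee_fin.
exists (fine (\int[P]_x (f x)%:E)%E); last by rewrite -lee_fin fineK.
by apply: has_integral_fin; rewrite ?fineK.
Qed.

Lemma integral_le_has_integral f g a : measurable_fun setT f -> (forall x, 0 <= f x) ->
  has_integral g a -> {ae P, forall x, f x <= g x} -> (\int[P]_x (f x)%:E <= a%:E)%E.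
Proof.
move=> mf f0 ga fg; have mg := has_integral_measurable ga.
case: ga => gi <-.
have mag : measurable_fun setT (fun x => `|(g x)%:E|%E).
  by apply: measurableT_comp => //; exact/measurable_EFinP.
(* The bound [g] is nonnegative only almost everywhere. Passing to its absolute value keeps the
   integral and makes monotonicity for nonnegative functions applicable. *)
have <- : (\int[P]_x `|(g x)%:E| = \int[P]_x (g x)%:E)%E.
  apply: ae_eq_integral => //; first exact/measurable_EFinP.
  by apply: filterS fg => x fgx _; rewrite abse_EFin ger0_norm// (le_trans (f0 x)).
apply: ae_ge0_le_integral => //; [by move=> x _; rewrite lee_fin|exact/measurable_EFinP|].
by apply: filterS fg => x fgx _; rewrite lee_fin (le_trans fgx)// ler_norm.
Qed.

End has_integral.

(** * Marginals and second moments under the product law *)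

Section power_measure_integrals.
Context {d : measure_display} {S : measurableType d} {R : realType}.
Variable P : probability S R.

Lemma power_measure_tnth m (j : 'I_m) (A : set S) : measurable A ->
  power_measure P m ((fun s => tnth s j) @^-1` A) = P A.
Proof.
move=> mA; elim: m j => [[]//|m IHm] j.
rewrite /= /distribution /pushforward /=.
have [j'|] := unliftP ord0 j => ->.
  rewrite (_ : _ @^-1` _ = setT `*` ((fun s => tnth s j') @^-1` A)).
    have mj' : measurable ((fun s : m.-tuple S => tnth s j') @^-1` A).
      by rewrite -[X in measurable X]setTI; exact: (measurable_tnth j').
    by rewrite product_measure1E//= probability_setT mul1e IHm.
  by apply/seteqP; split => [[a b]|[a b]] /=; rewrite tnthS// => -[].
rewrite (_ : _ @^-1` _ = A `*` setT).
  by rewrite product_measure1E//= probability_setT mule1.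
by apply/seteqP; split => [[a b]|[a b]] /=; rewrite tnth0// => -[].
Qed.

Lemma has_integral_tnth m (j : 'I_m) (f : S -> R) a : has_integral P f a ->
  has_integral (power_measure P m) (fun s => f (tnth s j)) a.
Proof.
move=> fa; have mf := has_integral_measurable fa; case: fa => fi fa.
have mj := @measurable_tnth _ S m j.
(* The nonnegative change of variables comes first: applied to the absolute value of [f], it yields
   the integrability that the signed version requires. *)
have ge0E (g : S -> \bar R) : measurable_fun setT g -> (forall x, (0 <= g x)%E) ->
    (\int[power_measure P m]_s g (tnth s j) = \int[P]_x g x)%E.
  move=> mg g0.
  rewrite -(@ge0_integral_pushforward _ _ _ _ R _ mj (power_measure P m) setT g)//.
  by apply: eq_measure_integral => A mA _; exact: power_measure_tnth.
have fji : (power_measure P m).-integrable setT (fun s => (f (tnth s j))%:E).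
  apply/integrableP; split; first by apply/measurable_EFinP; exact: measurableT_comp.
  rewrite (ge0E (fun x => `|(f x)%:E|)%E)//; last first.
    by apply: measurableT_comp => //; exact/measurable_EFinP.
  by have /integrableP[] := fi.
split=> //; rewrite -fa.
have mfE : measurable_fun setT (EFin \o f) by exact/measurable_EFinP.
have := @integral_pushforward _ _ _ _ R _ mj (power_measure P m) setT _ mfE fji measurableT.
rewrite preimage_setT => <-.
by apply: eq_measure_integral => A mA _; exact: power_measure_tnth.
Qed.

Context {n : nat}.
Implicit Type H : S -> 'rV[R]_n.

(** The cross term [2 dot (H s) c] integrates to 0 because [H] is centred. *)
Lemma integral_sqr_enormD H (V : R) (c : 'rV[R]_n) : measurable_fun setT H ->
  (forall i, has_integral P (fun s => H s 0 i) 0) ->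
  (\int[P]_s (enorm (H s) ^+ 2)%:E <= V%:E)%E ->
  (\int[P]_s (enorm (H s + c) ^+ 2)%:E <= (V + enorm c ^+ 2)%:E)%E.
Proof.
move=> mH H0 HV.
have mH2 : measurable_fun setT (fun s => enorm (H s) ^+ 2).
  by apply: measurable_funX; exact: measurable_enorm.
have [v v1 vV] := has_integral_ge0 mH2 (fun s => sqr_ge0 _) HV.
have dH : has_integral P (fun s => dot (H s) c) 0.
  by rewrite -(dot0 c); apply: has_integral_dot => i; rewrite mxE.
have [_] : has_integral P (fun s => enorm (H s + c) ^+ 2) (v + 2 * 0 + enorm c ^+ 2).
  under eq_fun do rewrite sqr_enormD.
  apply: has_integralD; last exact: has_integral_cst.
  by apply: has_integralD => //; exact: has_integralZ.
by move=> ->; rewrite lee_fin; lra.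
Qed.

(** Variances of independent centred vectors add up. The offset [c] makes the induction work: with
    the tail of the tuple frozen, the remaining sum plus [c] is a constant offset for the head. *)
Lemma integral_sqr_enorm_sum H (V : R) m (c : 'rV[R]_n) : measurable_fun setT H ->
  (forall i, has_integral P (fun s => H s 0 i) 0) ->
  (\int[P]_s (enorm (H s) ^+ 2)%:E <= V%:E)%E ->
  (\int[power_measure P m]_s (enorm (\sum_(j < m) H (tnth s j) + c) ^+ 2)%:E
     <= (m%:R * V + enorm c ^+ 2)%:E)%E.
Proof.
move=> mH H0 HV.
have msum k : measurable_fun setT (fun s : k.-tuple S => \sum_(j < k) H (tnth s j)).
  apply: measurable_rVP => i; under eq_fun do rewrite summxE.
  apply: measurable_sum => j; apply: (measurableT_comp (measurable_coord i)).
  by apply: measurableT_comp => //; exact: measurable_tnth.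
have madd d0 (T0 : measurableType d0) (f g : T0 -> 'rV[R]_n) : measurable_fun setT f ->
    measurable_fun setT g -> measurable_fun setT (fun t => f t + g t).
  move=> mf mg; apply: measurable_rVP => i; under eq_fun do rewrite mxE.
  by apply: measurable_funD; exact: (measurableT_comp (measurable_coord i)).
have mn d0 (T0 : measurableType d0) (f : T0 -> 'rV[R]_n) : measurable_fun setT f ->
    measurable_fun setT (fun t => (enorm (f t) ^+ 2)%:E).
  move=> mf; apply/measurable_EFinP; apply: measurable_funX; exact: measurable_enorm.
elim: m => [|m IHm].
  under eq_integral => s _ do rewrite big_ord0 add0r.
  by have [_ ->] := has_integral_cst (power_measure P 0) (enorm c ^+ 2); rewrite mul0r add0r.
have mS : measurable_fun setT
    (fun s : m.+1.-tuple S => (enorm (\sum_(j < m.+1) H (tnth s j) + c) ^+ 2)%:E).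
  by apply: (mn); apply: (madd _ _ _ (cst c)); [exact: msum|exact: measurable_cst].
have S0 (s : m.+1.-tuple S) :
  (0 <= (enorm (\sum_(j < m.+1) H (tnth s j) + c) ^+ 2)%:E)%E.
  by rewrite lee_fin sqr_ge0.
rewrite /= (ge0_integral_distribution _ mS S0).
rewrite (eq_integral (fun p : S * m.-tuple S =>
    (enorm (H p.1 + (\sum_(j < m) H (tnth p.2 j) + c)) ^+ 2)%:E)); last first.
  move=> p _ /=; rewrite /tcons big_ord_recl tnth0 addrA.
  congr (enorm (_ + _ + _) ^+ 2)%:E; apply: eq_bigr => j _; by rewrite tnthS.
(* This order integrates the head first with the tail fixed, which puts the inner integral in the
   form of [integral_sqr_enormD]. *)
rewrite fubini_tonelli2/=; last 2 first.
- apply: (mn); apply: (madd); first exact: measurableT_comp.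
  apply: (madd _ _ _ (cst c)); last exact: measurable_cst.
  exact: (measurableT_comp (msum m)).
- by move=> x; rewrite lee_fin sqr_ge0.
pose c' (s : m.-tuple S) := \sum_(j < m) H (tnth s j) + c.
have V0 : 0 <= V.
  by rewrite -lee_fin (le_trans _ HV)// integral_ge0// => s _; rewrite lee_fin sqr_ge0.
have mc' : measurable_fun setT c'.
  by apply: (madd _ _ _ (cst c)); [exact: msum|exact: measurable_cst].
apply: (@le_trans _ _ (\int[power_measure P m]_s (V%:E + (enorm (c' s) ^+ 2)%:E))%E).
  apply: ge0_le_integral => //.
  - by move=> s _; apply: integral_ge0 => x _; rewrite lee_fin sqr_ge0.
  - apply: (measurable_fun_fubini_tonelli_G (fun p : S * m.-tuple S =>
      (enorm (H p.1 + c' p.2) ^+ 2)%:E)).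
      apply: (mn); apply: (madd); exact: measurableT_comp.
    by move=> x; rewrite lee_fin sqr_ge0.
  - by apply: emeasurable_funD => //; exact: mn.
  - by move=> s _; rewrite -EFinD /fubini_G/=;
      apply: le_trans (integral_sqr_enormD (c' s) mH H0 HV).
rewrite ge0_integralD//; last 2 first.
- by move=> s _; rewrite lee_fin sqr_ge0.
- exact: mn.
rewrite integral_cst//= probability_setT mule1 -natr1 mulrDl mul1r.
rewrite (addrC (_ * V)) -addrA EFinD; apply: leeD2l; exact: IHm.
Qed.

End power_measure_integrals.

(** * Independence of the past and the next minibatch *)

Section independence.
Context {d : measure_display} {T : measurableType d} {R : realType}.
Context {d' : measure_display} {S : measurableType d'} {I : eqType}.
Variables (Pr : probability T R) (P : probability S R) (V : I -> T -> S).
Hypothesis mV : forall i, measurable_fun setT (V i).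

Let event (J : seq I) (B : I -> set S) : set T :=
  \bigcap_(i in [set` J]) (V i @^-1` B i).

(** [K] marks the indices whose variables may already have been used to build [U]. Since the
    right-hand side is written with [P], the property also records that the other variables are
    independent of each other with law [P]. *)
Definition independent_outside (dH : measure_display) (H : measurableType dH)
    (U : T -> H) (K : I -> bool) :=
  forall (J : seq I) (A : set H) (B : I -> set S),
    uniq J -> (forall i, i \in J -> ~~ K i) ->
    measurable A -> (forall i, measurable (B i)) ->
    Pr (U @^-1` A `&` \bigcap_(i in [set` J]) (V i @^-1` B i)) =
    (Pr (U @^-1` A) * \prod_(i <- J) P (B i))%E.

Let measurable_event J B : (forall i, measurable (B i)) -> measurable (event J B).
Proof.
move=> mB; apply: fin_bigcap_measurable => // i _.
by rewrite -[X in measurable X]setTI; exact: mV.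
Qed.

Section one_variable.
Context {dH : measure_display} {H : measurableType dH}.
Variables (U : {mfun T >-> H}) (K : I -> bool) (i : I).
Hypothesis iK : ~~ K i.
Hypothesis UK : independent_outside U K.

Let mUV : measurable_fun setT (fun w => (U w, V i w)).
Proof. by apply: measurable_fun_pair. Qed.

Let UV : {mfun T >-> (H * S)%type} := mfun_Sub (mem_set mUV).

Let rect J A (B : I -> set S) C : uniq J -> i \notin J ->
  (forall j, j \in J -> ~~ K j) -> measurable A -> measurable C ->
  (forall j, measurable (B j)) ->
  Pr ((U @^-1` A `&` V i @^-1` C) `&` event J B) =
  (Pr (U @^-1` A) * (P C * \prod_(j <- J) P (B j)))%E.
Proof.
move=> uJ iJ JK mA mC mB.
(* The constraint on [V i] is absorbed into the family of events, so that the hypothesis applies to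
   the longer list [i :: J]. *)
pose B' j := if j == i then C else B j.
have B'J j : j \in J -> B' j = B j.
  by move=> jJ; rewrite /B'; case: eqP => // ji; rewrite -ji jJ in iJ.
have := @UK (i :: J) A B'.
rewrite big_cons.
have -> : B' i = C by rewrite /B' eqxx.
rewrite (eq_big_seq (fun j => P (B j))); last first.
  by move=> j jJ; rewrite B'J.
move=> <-//.
- congr (Pr _); rewrite -setIA; congr (_ `&` _); apply/seteqP; split => w.
    move=> [Cw Jw] j; rewrite /= inE => /orP[/eqP ->|jJ]; first by rewrite /B' /= eqxx.
    by rewrite B'J//; exact: Jw.
  move=> h; split; first by have := h i (mem_head _ _); rewrite /B' eqxx.
  by move=> j jJ; rewrite /= -(B'J j)//; apply: h; rewrite /= inE jJ orbT.
- by rewrite /= iJ.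
- by move=> j; rewrite inE => /orP[/eqP ->|/JK].
- by move=> j; rewrite /B'; case: ifP.
Qed.

Let rect0 A C : measurable A -> measurable C ->
  Pr (U @^-1` A `&` V i @^-1` C) = (Pr (U @^-1` A) * P C)%E.
Proof.
move=> mA mC; have := @rect [::] A (fun=> setT) C isT isT.
rewrite big_nil mule1 /event set_nil bigcap_set0 setIT; exact.
Qed.

Let prod_law_fin J (B : I -> set S) : (forall j, measurable (B j)) ->
  exists e : {nonneg R}, (\prod_(j <- J) P (B j) = (e%:num)%:E)%E.
Proof.
move=> mB; elim: J => [|j J [e IHJ]]; first by exists 1%:nng; rewrite big_nil.
have Pf : P (B j) \is a fin_num by exact: fin_num_measure.
have P0 : 0 <= fine (P (B j)) by rewrite fine_ge0.
by exists ((NngNum P0)%:num * e%:num)%:nng; rewrite big_cons IHJ /= EFinM fineK.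
Qed.

(** For a fixed event on the remaining indices, both sides are measures in [C]. They agree with the
    same product measure on rectangles, hence everywhere by uniqueness of product measures. *)
Lemma independent_outside_pair :
  independent_outside (fun w => (U w, V i w)) (fun j => K j || (j == i)).
Proof.
move=> J C B uJ JK mC mB.
have [e eE] := prod_law_fin J mB.
have mE := measurable_event J mB.
have iJ : i \notin J by apply/negP => /JK; rewrite eqxx orbT.
have JK' j : j \in J -> ~~ K j by move=> /JK; rewrite negb_or => /andP[].
(* The factor [e] is the product of the probabilities of the remaining events. Then [m1 \x P] is the
   law of the pair restricted to those events, and also [e] times its unrestricted law. *)
pose m1 := mscale e (distribution Pr U).
have h1 := @product_measure_unique _ _ _ _ R m1 P (pushforward (mrestr Pr mE) UV).
have h2 := @product_measure_unique _ _ _ _ R m1 P (mscale e (distribution Pr UV)).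
rewrite eE muleC; transitivity ((m1 \x P)%E C).
  rewrite h1// => A D mA mD.
  have := rect uJ iJ JK' mA mD mB; rewrite eE => h.
  transitivity (Pr ((U @^-1` A `&` V i @^-1` D) `&` event J B)) => //.
  by rewrite h /m1 /mscale/= (muleC (P D)) muleA (muleC _ (e%:num)%:E).
rewrite h2// => A D mA mD.
by rewrite /m1 /mscale/= -muleA; congr (_ * _)%E; exact: rect0.
Qed.

(** The law of the pair is the product of the law of [U] and [P], so Tonelli's theorem integrates
    the fresh variable out. *)
Lemma integral_independent_pair (f : H * S -> \bar R) : measurable_fun setT f ->
  (forall z, 0 <= f z)%E ->
  (\int[Pr]_w f (U w, V i w) = \int[Pr]_w \int[P]_v f (U w, v))%E.
Proof.
move=> mf f0.
transitivity (\int[distribution Pr UV]_z f z)%E.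
  by rewrite (ge0_integral_distribution _ mf f0).
transitivity (\int[(distribution Pr U \x P)]_z f z)%E.
  apply: eq_measure_integral => C mC _; apply/esym.
  by apply: product_measure_unique => // A D mA mD; exact: rect0.
rewrite fubini_tonelli1// ge0_integral_distribution//.
- exact: measurable_fun_fubini_tonelli_F.
- by move=> y; apply: integral_ge0.
Qed.

End one_variable.

Lemma independent_outside_comp (d1 d2 : measure_display) (H1 : measurableType d1)
    (H2 : measurableType d2) (U : T -> H1) (phi : H1 -> H2) (K : I -> bool) :
  measurable_fun setT phi -> independent_outside U K ->
  independent_outside (phi \o U) K.
Proof.
move=> mphi UK J A B uJ JK mA mB.
have := UK J (phi @^-1` A) B uJ JK; apply => //.
by rewrite -[X in measurable X]setTI; exact: mphi.
Qed.

Lemma independent_outside_sub (dH : measure_display) (H : measurableType dH)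
    (U : T -> H) (K K' : I -> bool) : (forall i, K i -> K' i) ->
  independent_outside U K -> independent_outside U K'.
Proof.
move=> KK' UK J A B uJ JK; apply: UK => // i /JK; exact/contra/KK'.
Qed.

Lemma measurable_map_tuple m (l : m.-tuple I) :
  measurable_fun setT (fun w => map_tuple (V^~ w) l).
Proof.
apply/measurable_fun_tnthP => j; rewrite (_ : _ \o _ = V (tnth l j))//.
by apply/funext => w /=; rewrite tnth_map.
Qed.

(* The variables are absorbed one at a time, which avoids a generating
   pi-system for the sigma-algebra of the past. *)
Lemma independent_outside_tuple (dH : measure_display) (H : measurableType dH)
    (U : {mfun T >-> H}) (K : I -> bool) m (l : m.-tuple I) :
  independent_outside U K -> uniq l -> (forall i, i \in l -> ~~ K i) ->
  independent_outside (fun w => (U w, map_tuple (V^~ w) l))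
    (fun i => K i || (i \in l)) /\
  (forall f : H * m.-tuple S -> \bar R, measurable_fun setT f ->
     (forall z, 0 <= f z)%E ->
     \int[Pr]_w f (U w, map_tuple (V^~ w) l) =
     \int[Pr]_w \int[power_measure P m]_s f (U w, s))%E.
Proof.
move=> UK; elim: m l => [|m IHm] l.
  move=> _ _; rewrite (tuple0 l).
  have tE (w : T) : map_tuple (V^~ w) [tuple] = [tuple] by exact: val_inj.
  split.
    have mphi : measurable_fun setT (fun u : H => (u, [tuple] : 0.-tuple S)).
      by apply: measurable_fun_pair => //; exact: measurable_cst.
    have := independent_outside_comp mphi UK.
    under [X in _ -> independent_outside X _]eq_fun do rewrite tE.
    by apply: independent_outside_sub => i ->.
  move=> f mf f0; apply: eq_integral => w _; rewrite tE.
  rewrite integral_dirac//= ?diracT ?mul1e//.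
  exact: (measurableT_comp mf (measurable_pair1 _)).
case/tupleP: l => i l /= /andP[il ul] lK.
have iK : ~~ K i by apply: lK; rewrite mem_head.
have [|WK fW] := IHm l ul.
  by move=> j jl; apply: lK; rewrite inE jl orbT.
have mW : measurable_fun setT (fun w => (U w, map_tuple (V^~ w) l)).
  by apply: measurable_fun_pair => //; exact: measurable_map_tuple.
pose W : {mfun T >-> (H * m.-tuple S)%type} := mfun_Sub (mem_set mW).
have iK' : ~~ (K i || (i \in l)) by rewrite negb_or iK.
have mphi : measurable_fun setT
    (fun z : (H * m.-tuple S) * S => (z.1.1, tcons (z.2, z.1.2))).
  apply: measurable_fun_pair; first exact: measurableT_comp.
  apply: measurableT_comp => //; apply: measurable_fun_pair => //.
  exact: measurableT_comp.
have tE (w : T) : map_tuple (V^~ w) [tuple of i :: l]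
    = tcons (V i w, map_tuple (V^~ w) l) by exact: val_inj.
split.
  have := independent_outside_comp mphi (independent_outside_pair (U := W) iK' WK).
  under [X in _ -> independent_outside X _]eq_fun do rewrite tE.
  by apply: independent_outside_sub => j; rewrite inE -orbA (orbC (j \in l)).
move=> f mf f0.
under eq_integral do rewrite tE.
have mfphi := measurableT_comp mf mphi.
rewrite (integral_independent_pair (U := W) iK' WK mfphi (fun z => f0 _))/=.
(* [V i] has been integrated out, with the other variables kept in [W]; the induction hypothesis now
   applies to the resulting function [g]. *)
pose g (z : H * m.-tuple S) := (\int[P]_v f (z.1, tcons (v, z.2)))%E.
have mg : measurable_fun setT g.
  exact: (measurable_fun_fubini_tonelli_F _ mfphi (fun z => f0 _)).
rewrite (fW g mg); last by move=> z; exact: integral_ge0.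
apply: eq_integral => w _; rewrite /g/=.
have mfw : measurable_fun setT (fun s : m.+1.-tuple S => f (U w, s)).
  exact: (measurableT_comp mf (measurable_pair1 _)).
rewrite (ge0_integral_distribution _ mfw)// fubini_tonelli2//; last by move=> z; exact: f0.
by apply: measurableT_comp.
Qed.

End independence.

(** * One step *)

Section one_step.
Context {R : realType} {n : nat} {d : measure_display} {S : measurableType d}.
Variables (P : probability S R) (X : set 'rV[R]_n) (F : 'rV[R]_n -> S -> \bar R).
Hypothesis X_convex : convex_set X.
Hypothesis F_subdiff : forall s, subdifferentiable_on X (F^~ s).
Hypothesis F_integrable : forall x, X x -> P.-integrable setT (F x).
Variable xstar : 'rV[R]_n.
Hypothesis xstar_min : argmin X (objective P F) xstar.
Variable gradf : 'rV[R]_n -> 'rV[R]_n.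
Hypothesis gradf_unbiased : forall x, X x ->
  forall G, subgradient_selection F x G ->
  forall i, ('E_P[fun s => (G s 0 i)%R] = (gradf x 0 i)%R%:E)%E.
Variables L lambda sigma : R.
Hypothesis gradf_Lipschitz : forall x y, X x -> X y ->
  enorm (gradf x - gradf y) <= L * enorm (x - y).
Hypothesis lambda_gt0 : 0 < lambda.
Hypothesis growth : forall x, X x ->
  ((lambda * dist x (argmin X (objective P F)) ^+ 2)%R%:E
     <= objective P F x - objective P F xstar)%E.
Hypothesis noise : forall x, X x ->
  forall G, subgradient_selection F x G ->
  ('E_P[fun s => (enorm (gradf x - G s) ^+ 2)%R]
     <= (sigma ^+ 2 * dist x (argmin X (objective P F)) ^+ 2)%R%:E)%E.
Hypothesis lambda_le_L : lambda <= L.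
Variable m : nat.
Hypothesis m_ge1 : (1 <= m)%N.
Variable Fm : 'rV[R]_n -> m.-tuple S -> 'rV[R]_n -> \bar R.
Hypothesis Fm_convex : forall x s, X x -> convex_on X (Fm x s).
Hypothesis Fm_subdiff : forall x s, X x -> subdifferentiable_on X (Fm x s).
Hypothesis Fm_below : forall x s y, X x -> X y ->
  (Fm x s y <= sample_average F s y)%E.
Hypothesis Fm_exact : forall x s, X x -> Fm x s x = sample_average F s x.
Hypothesis Fm_subgrad : forall x s, X x ->
  subdiff (Fm x s) x `<=` subdiff (sample_average F s) x.
Hypothesis average_subgrad : forall x (g : m.-tuple S -> 'rV[R]_n), X x ->
  (forall s, subdiff (sample_average F s) x (g s)) ->
  exists2 G : S -> 'rV[R]_n, subgradient_selection F x G &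
    {ae power_measure P m, forall s : m.-tuple S,
       g s = m%:R^-1 *: \sum_(j < m) G (tnth s j)}.

Implicit Types x y : 'rV[R]_n.

Let Xs := argmin X (objective P F).
Let L_gt0 : 0 < L := lt_le_trans lambda_gt0 lambda_le_L.
Let D x := dist x Xs.
Let f x := fine (objective P F x).
Let Fbar x (s : m.-tuple S) := m%:R^-1 * \sum_(j < m) fine (F x (tnth s j)).

Lemma subdifferentiable_fin (A : set 'rV[R]_n) (h : 'rV[R]_n -> \bar R) x :
  subdifferentiable_on A h -> A x -> h x \is a fin_num.
Proof. by move=> hA Ax; have [g []] := hA x Ax. Qed.

Lemma has_integral_objective x : X x -> has_integral P (fun s => fine (F x s)) (f x).
Proof.
move=> Xx; have FE (s : S) : (fine (F x s))%:E = F x s.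
  by rewrite fineK// (subdifferentiable_fin (F_subdiff s) Xx).
have iF := F_integrable Xx.
split; first by rewrite (_ : EFin \o _ = F x)//; apply/funext => s; exact: FE.
under eq_integral do rewrite FE.
by rewrite fineK//; exact: (integrable_fin_num measurableT iF).
Qed.

Let objectiveE x : X x -> objective P F x = (f x)%:E.
Proof.
move=> Xx; rewrite fineK//.
exact: (integrable_fin_num measurableT (F_integrable Xx)).
Qed.

Lemma sample_averageE (s : m.-tuple S) x : X x -> sample_average F s x = (Fbar x s)%:E.
Proof.
move=> Xx; rewrite /sample_average /Fbar EFinM EFin_sum_fine// => j _.
exact: (subdifferentiable_fin (F_subdiff _) Xx).
Qed.

Lemma has_integral_sample_average x : X x ->
  has_integral (power_measure P m) (Fbar x) (f x).
Proof.
move=> Xx; have -> : f x = m%:R^-1 * \sum_(j < m) f x.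
  by rewrite sumr_const card_ord -[f x *+ m]mulr_natl mulrA mulVf ?mul1r// pnatr_eq0 -lt0n.
apply: has_integralZ; apply: has_integral_sum => j.
exact: has_integral_tnth (has_integral_objective Xx).
Qed.

(** The subgradients [g] are chosen pointwise and need not be measurable. The almost sure identity
    with the measurable selection [G] is what allows estimates involving [g] to be integrated. *)
Lemma model_selection x : X x -> exists (g : m.-tuple S -> 'rV[R]_n) (G : S -> 'rV[R]_n),
  [/\ forall s, subdiff (Fm x s) x (g s), subgradient_selection F x G &
      {ae power_measure P m, forall s : m.-tuple S,
         g s = m%:R^-1 *: \sum_(j < m) G (tnth s j)}].
Proof.
move=> Xx; have /choice[g gP] : forall s, exists u, subdiff (Fm x s) x u.
  by move=> s; exact: (Fm_subdiff s Xx Xx).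
have [|G GP gG] := average_subgrad Xx (g := g); last by exists g, G.
by move=> s; apply: Fm_subgrad.
Qed.

Lemma has_integral_selection x G : X x -> subgradient_selection F x G ->
  forall i, has_integral P (fun s => G s 0 i) (gradf x 0 i).
Proof.
move=> Xx GP i; apply: has_integral_fin; last first.
  by have := gradf_unbiased Xx GP i; rewrite unlock.
by case: GP => mG _; exact: (measurableT_comp (measurable_coord i)).
Qed.

(** Integrate the subgradient inequality of each [F(.; s)] at [x] along a measurable selection,
    whose mean is [gradf x]. *)
Lemma objective_subgradient x y : X x -> X y -> f x + dot (gradf x) (y - x) <= f y.
Proof.
move=> Xx Xy; have [_ [G [_ GP _]]] := model_selection Xx.
have hG := has_integral_dot (y - x) (has_integral_selection Xx GP).
apply: (has_integral_le (has_integralD (has_integral_objective Xx) hG)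
  (has_integral_objective Xy)) => s.
have [Ffin Fsub] := GP.2 s.
have Ffiny := subdifferentiable_fin (F_subdiff s) Xy.
rewrite -lee_fin EFinD !fineK//; exact: Fsub.
Qed.

Lemma objective_descent x y : X x -> X y ->
  f y <= f x + dot (gradf x) (y - x) + L / 2 * enorm (y - x) ^+ 2.
Proof.
exact: (descent_lemma X_convex objective_subgradient gradf_Lipschitz).
Qed.

Lemma objective_growth x y : X x -> Xs y -> lambda * D x ^+ 2 <= f x - f y.
Proof.
move=> Xx [Xy ymin]; have := growth Xx; have := ymin _ xstar_min.1.
rewrite !objectiveE//; last exact: xstar_min.1.
by rewrite -EFinB !lee_fin -/(D x); lra.
Qed.

Lemma model_step_le x y (s : m.-tuple S) eta (p g : 'rV[R]_n) : X x -> Xs y -> 0 <= eta ->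
  argmin X (prox_objective Fm (L + eta)^-1 x s) p ->
  subdiff (Fm x s) x g -> (0 < eta \/ gradf x - g = 0) ->
  ((L + eta) / 2 + lambda) * D p ^+ 2 <=
    (L + eta) / 2 * enorm (x - y) ^+ 2 + (Fbar y s - Fbar x s) + (f x - f y)
    + (2 * eta)^-1 * enorm (gradf x - g) ^+ 2.
Proof.
move=> Xx ys eta0 pmin [_ gsub] etag.
have Xy := ys.1; have Xp := pmin.1.
have c0 : 0 <= (L + eta) / 2 by move: L_gt0; lra.
have Mfin z : X z -> Fm x s z \is a fin_num := subdifferentiable_fin (Fm_subdiff s Xx).
have pmin' : argmin X (fun z => Fm x s z + ((L + eta) / 2 * enorm (z - x) ^+ 2)%:E)%E p.
  move: pmin; rewrite /prox_objective.
  by rewrite (_ : (2 * (L + eta)^-1)^-1 = (L + eta) / 2)// invfM invrK mulrC.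
have h1 := prox_three_point X_convex (Fm_convex s Xx) Mfin c0 pmin' Xy.
have h2 : Fbar x s + dot g (p - x) <= fine (Fm x s p).
  have := gsub p; rewrite Fm_exact// sample_averageE//.
  by rewrite -(fineK (Mfin _ Xp)) -EFinD lee_fin.
have h3 : fine (Fm x s y) <= Fbar y s.
  by have := Fm_below s Xx Xy; rewrite sample_averageE// -(fineK (Mfin _ Xy)) lee_fin.
have h4 := objective_descent Xx Xp.
have h5 := objective_growth Xp ys.
have h6 : D p ^+ 2 <= enorm (y - p) ^+ 2.
  rewrite -(enormN (y - p)) opprB ler_sqr ?nnegrE ?dist_ge0 ?enorm_ge0//.
  exact: dist_le.
have h7 : dot (gradf x - g) (p - x) <=
    eta / 2 * enorm (p - x) ^+ 2 + (2 * eta)^-1 * enorm (gradf x - g) ^+ 2.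
  case: etag => [e0|->]; first exact: dot_young.
  rewrite dot0 addr_ge0// mulr_ge0 ?sqr_ge0 ?invr_ge0//; lra.
have h8 : (L + eta) / 2 * D p ^+ 2 <= (L + eta) / 2 * enorm (y - p) ^+ 2.
  exact: ler_wpM2l.
rewrite -(enormN (x - y)) opprB; move: h7; rewrite dotDl dotNl; lra.
Qed.

(** The [m] centred errors contribute at most [m sigma^2 (D x)^2], and the average scales this by
    [1 / m^2]. *)
Lemma average_noise x G : X x -> subgradient_selection F x G ->
  exists2 v, has_integral (power_measure P m)
    (fun s => enorm (gradf x - m%:R^-1 *: \sum_(j < m) G (tnth s j)) ^+ 2) v &
    v <= sigma ^+ 2 / m%:R * D x ^+ 2.
Proof.
move=> Xx GP; have mG := GP.1.
pose H (s : S) := G s - gradf x.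
have mH : measurable_fun setT H := measurable_rV_sub _ mG.
have H0 i : has_integral P (fun s => H s 0 i) 0.
  rewrite (_ : (fun s => _) = fun s => G s 0 i + - gradf x 0 i); last first.
    by apply/funext => s; rewrite !mxE.
  rewrite -(subrr (gradf x 0 i)).
  exact: has_integralD (has_integral_selection Xx GP i) (has_integral_cst _ _).
have HV : (\int[P]_s (enorm (H s) ^+ 2)%:E <= (sigma ^+ 2 * D x ^+ 2)%:E)%E.
  have := noise Xx GP; rewrite unlock; apply: le_trans; rewrite le_eqVlt; apply/orP; left.
  by apply/eqP/eq_integral => s _; rewrite /H -enormN opprB.
have := integral_sqr_enorm_sum m 0 mH H0 HV.
have m0 : m%:R != 0 :> R by rewrite pnatr_eq0 -lt0n.
have eE (s : m.-tuple S) : enorm (gradf x - m%:R^-1 *: \sum_(j < m) G (tnth s j)) ^+ 2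
    = (m%:R^-1) ^+ 2 * enorm (\sum_(j < m) H (tnth s j) + 0) ^+ 2.
  rewrite -sqr_enormZ -enormN opprB addr0; congr (enorm _ ^+ 2).
  rewrite /H sumrB sumr_const card_ord scalerBr
    -[gradf x *+ m]scaler_nat scalerA.
  by rewrite mulVf// scale1r.
move=> /has_integral_ge0[||v hv vle].
- apply: measurable_funX; apply: measurable_enorm; apply: measurable_rVP => i.
  under eq_fun do rewrite addr0 summxE.
  apply: measurable_sum => j; apply: (measurableT_comp (measurable_coord i)).
  by apply: measurableT_comp => //; exact: measurable_tnth.
- by move=> s; exact: sqr_ge0.
exists (m%:R^-1 ^+ 2 * v).
  by under eq_fun do rewrite eE; exact: has_integralZ.
have -> : sigma ^+ 2 / m%:R * D x ^+ 2 =
    m%:R^-1 ^+ 2 * (m%:R * (sigma ^+ 2 * D x ^+ 2)) by field.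
rewrite ler_wpM2l ?sqr_ge0//; move: vle.
by rewrite sqr_enorm dot0 addr0.
Qed.

(* At [eta = 0] the junk value [(2 * eta)^-1 = 0] gives the right bound, because
   the noise vanishes almost surely when [D x = 0]. *)
Lemma one_step_le x eta (T : m.-tuple S -> 'rV[R]_n) :
  X x -> 0 <= eta -> (0 < eta \/ D x = 0) -> measurable_fun setT T ->
  (forall s, argmin X (prox_objective Fm (L + eta)^-1 x s) (T s)) ->
  (\int[power_measure P m]_s (D (T s) ^+ 2)%:E <=
    (((L + eta) / 2 + lambda)^-1 *
      ((L + eta) / 2 + (2 * eta)^-1 * (sigma ^+ 2 / m%:R)) * D x ^+ 2)%:E)%E.
Proof.
move=> Xx eta0 etaD mT Tmin.
have [g [G [gP GP gG]]] := model_selection Xx.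
have [v hv vle] := average_noise Xx GP.
set c := (L + eta) / 2; have c0 : 0 < c by rewrite /c; move: L_gt0; lra.
have cl : 0 < c + lambda by rewrite addr_gt0.
pose e (s : m.-tuple S) := gradf x - m%:R^-1 *: \sum_(j < m) G (tnth s j).
have ae_e : {ae power_measure P m, forall s, 0 < eta \/ e s = 0}.
  case: etaD => [e0|D0]; first by apply: aeW => s; left.
  have v0 : v = 0.
    apply/eqP; rewrite eq_le; move: vle; rewrite D0 expr0n mulr0 => -> /=.
    apply: (has_integral_le (has_integral_cst _ 0) hv) => s; exact: sqr_ge0.
  have me := has_integral_measurable hv.
  have /measurable_EFinP me' := me.
  have := (ae_eq_integral_abs (power_measure P m) measurableT me').1.
  under eq_integral => s _ do rewrite /= ger0_norm ?sqr_ge0//.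
  rewrite hv.2 v0 => /(_ erefl).
  apply: filterS => s /(_ I)[] /eqP; rewrite sqrf_eq0 => /eqP es; right.
  exact: enorm_eq0.
have mD : measurable_fun setT (fun s => D (T s) ^+ 2).
  apply: measurable_funX; apply: measurableT_comp => //.
  by apply: measurable_dist; exists xstar.
(* The estimate is first integrated for one fixed solution [y]; the means of the two differences,
   [f y - f x] and [f x - f y], then cancel. *)
have bound y : Xs y -> (\int[power_measure P m]_s (D (T s) ^+ 2)%:E <=
    ((c + lambda)^-1 * (c * enorm (x - y) ^+ 2 + (f y + -1 * f x) + (f x - f y)
      + (2 * eta)^-1 * v))%:E)%E.
  move=> ys; have Xy := ys.1.
  apply: (@integral_le_has_integral _ _ _ _ _ (fun s => (c + lambda)^-1 *
    (c * enorm (x - y) ^+ 2 + (Fbar y s + -1 * Fbar x s) + (f x - f y)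
      + (2 * eta)^-1 * enorm (e s) ^+ 2))) => //.
  - by move=> s; exact: sqr_ge0.
  - apply: has_integralZ; apply: has_integralD; last exact: has_integralZ.
    apply: has_integralD; last exact: has_integral_cst.
    apply: has_integralD; first exact: has_integral_cst.
    apply: has_integralD; first exact: has_integral_sample_average.
    by apply: has_integralZ; exact: has_integral_sample_average.
  - apply: filterS2 gG ae_e => s gs es.
    rewrite -ler_pdivrMl ?invr_gt0// invrK mulN1r.
    have := model_step_le Xx ys eta0 (Tmin s) (gP s).
    by rewrite gs -/(e s) => /(_ es).
have [I hI _] := has_integral_ge0 mD (fun s => sqr_ge0 _) (bound _ xstar_min).
rewrite hI.2 lee_fin -mulrA ler_pdivlMl//.
apply: (@le_linear_limit _ _ _ (c * (2 * D x + 1))) => t /andP[t0 t1].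
(* A solution within [D x + t] of [x] stands in for a nearest one; as [t <= 1], the square exceeds
   [(D x)^2] by at most [t (2 D x + 1)]. *)
have [|y ys yx] := @dist_approx _ _ Xs x t _ t0; first by exists xstar.
have := bound y ys; rewrite hI.2 lee_fin ler_pdivlMl//.
move/le_trans; apply.
have D0 : 0 <= D x := dist_ge0 _ _.
have h1 : enorm (x - y) ^+ 2 <= (D x + t) ^+ 2.
  by rewrite ler_sqr ?nnegrE ?enorm_ge0 ?addr_ge0// ltW.
have h2 : (D x + t) ^+ 2 <= D x ^+ 2 + t * (2 * D x + 1) by nra.
have h3 : c * enorm (x - y) ^+ 2 <= c * (D x ^+ 2 + t * (2 * D x + 1)).
  by rewrite ler_pM2l// (le_trans h1).
have h4 : (2 * eta)^-1 * v <= (2 * eta)^-1 * (sigma ^+ 2 / m%:R * D x ^+ 2).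
  by rewrite ler_wpM2l// invr_ge0; lra.
by lra.
Qed.

Lemma one_step_contraction_gt0 x eta (T : m.-tuple S -> 'rV[R]_n) :
  X x -> 0 < eta -> measurable_fun setT T ->
  (forall s, argmin X (prox_objective Fm (L + eta)^-1 x s) (T s)) ->
  (\int[power_measure P m]_s (D (T s) ^+ 2)%:E <=
    (expR (- (2^-1 * (lambda * (L + eta)^-1))
       + sigma ^+ 2 / m%:R * ((L + eta)^-1 / eta)) * D x ^+ 2)%:E)%E.
Proof.
move=> Xx eta0 mT Tmin.
apply: le_trans (one_step_le Xx (ltW eta0) (or_introl eta0) mT Tmin) _.
rewrite lee_fin ler_wpM2r ?sqr_ge0//.
have Le0 : 0 < L + eta by rewrite addr_gt0.
set a := (L + eta)^-1; have a0 : 0 < a by rewrite invr_gt0.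
set V := sigma ^+ 2 / m%:R.
have V0 : 0 <= V by rewrite divr_ge0// sqr_ge0.
have la1 : lambda * a <= 1.
  by rewrite ler_pdivrMr// mul1r (le_trans lambda_le_L)// lerDl ltW.
have la0 : 0 < lambda * a by rewrite mulr_gt0.
have -> : ((L + eta) / 2 + lambda)^-1 * ((L + eta) / 2 + (2 * eta)^-1 * V) =
    (1 + 2 * (lambda * a))^-1 * (1 + V * (a / eta)).
  by rewrite /a; field; rewrite !gt_eqF// addr_gt0// mulr_gt0.
rewrite expRD ler_pM ?expR_ge1Dx//.
- by rewrite invr_ge0; lra.
- by rewrite addr_ge0// mulr_ge0// divr_ge0// ltW.
(* With [z = lambda a] in [[0, 1]], [(1 + 2 z)(1 - z / 2) = 1 + 3 z / 2 - z^2 >= 1], hence [1 / (1 +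
   2 z) <= 1 - z / 2 <= exp (- z / 2)]. *)
apply: le_trans (expR_ge1Dx _).
by rewrite -div1r ler_pdivrMr; nra.
Qed.

(* For [eta = 0] the right-hand side is [+oo * (D x)^2], which is [0] when [D x = 0]. *)
Lemma one_step_contraction x eta (T : m.-tuple S -> 'rV[R]_n) :
  X x -> 0 <= eta -> measurable_fun setT T ->
  (forall s, argmin X (prox_objective Fm (L + eta)^-1 x s) (T s)) ->
  (\int[power_measure P m]_s (D (T s) ^+ 2)%:E <=
    expeR ((- (2^-1 * (lambda * (L + eta)^-1)))%:E +
      if eta == 0%R then +oo
      else (sigma ^+ 2 / m%:R * ((L + eta)^-1 / eta))%:E) * (D x ^+ 2)%:E)%E.
Proof.
move=> Xx eta0 mT Tmin; case: eqVneq => [e0|en0]; last first.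
  apply: (one_step_contraction_gt0 Xx _ mT Tmin).
  by rewrite lt_def en0.
have [Dx0|Dx0] := eqVneq (D x) 0.
  apply: le_trans (one_step_le Xx eta0 (or_intror Dx0) mT Tmin) _.
  by rewrite Dx0 expr0n mulr0 mule0.
rewrite addey// gt0_mulye ?leey// lte_fin exprn_gt0// lt_def Dx0; exact: dist_ge0.
Qed.

End one_step.

(** * Iterates *)

Lemma mutually_independent_seq (d : measure_display) (T : measurableType d)
    (R : realType) (P : probability T R) (I : choiceType) (G : I -> set (set T))
    (J : seq I) (A : I -> set T) : mutually_independent P G -> uniq J ->
  (forall i, i \in J -> G i (A i)) ->
  P (\bigcap_(i in [set` J]) A i) = (\prod_(i <- J) P (A i))%E.
Proof.
move=> PG uJ GA; have := PG (seq_fset tt J) A.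
rewrite (perm_big _ (seq_fset_perm tt J))/= undup_id// => <-.
  congr (P _); apply/seteqP; split => w h i iJ; apply: h; move: iJ.
    by rewrite /= (seq_fsetE tt J i).
  by rewrite /= (seq_fsetE tt J i).
by move=> i; rewrite (seq_fsetE tt J i); exact: GA.
Qed.

(** * Independence of the starting point from the samples *)

Section starting_point.
Context {d : measure_display} {T : measurableType d} {R : realType}.
Context {d' : measure_display} {S : measurableType d'} {I : choiceType}.
Context {dH : measure_display} {H : measurableType dH}.
Variables (Pr : probability T R) (P : probability S R) (V : I -> T -> S).
Hypothesis V_law : forall i A, measurable A -> Pr (V i @^-1` A) = P A.

Lemma independent_outside_cst (u : H) :
  mutually_independent Pr (fun i => g_sigma_algebra_preimage (V i)) ->
  independent_outside Pr P V (fun=> u) (fun=> false).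
Proof.
move=> VI J A B uJ _ mA mB.
have -> : (\prod_(i <- J) P (B i) = Pr (\bigcap_(i in [set` J]) (V i @^-1` B i)))%E.
  rewrite (mutually_independent_seq VI uJ).
    by apply: eq_bigr => i _; rewrite V_law.
  by move=> i _; exists (B i) => //; rewrite setTI.
have [Au|Au] := pselect (A u).
  rewrite (_ : _ @^-1` A = setT) ?setTI ?probability_setT ?mul1e//.
  by apply/seteqP; split.
rewrite (_ : _ @^-1` A = set0) ?set0I ?measure0 ?mul0e//.
by apply/seteqP; split.
Qed.

Lemma independent_outside_start (U : T -> H) :
  mutually_independent Pr (fun o : option I =>
    if o is Some i then g_sigma_algebra_preimage (V i)
    else g_sigma_algebra_preimage U) ->
  independent_outside Pr P V U (fun=> false).
Proof.
move=> UVI J A B uJ _ mA mB.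
pose E (o : option I) := if o is Some i then V i @^-1` B i else U @^-1` A.
have uJ' : uniq (None :: map Some J).
  rewrite cons_uniq map_inj_uniq ?uJ ?andbT; last by move=> ? ? [].
  by apply/negP => /mapP[].
have := mutually_independent_seq (A := E) UVI uJ' _.
rewrite big_cons big_map /=.
have -> : (\prod_(i <- J) Pr (V i @^-1` B i) = \prod_(i <- J) P (B i))%E.
  by apply: eq_bigr => i _; rewrite V_law.
move=> <-; last first.
  by move=> [i|] ?; [exists (B i)|exists A] => //; rewrite setTI.
- congr (Pr _); apply/seteqP; split => [w [Aw Jw]|w h].
    by move=> [i|]//=; rewrite inE/= mem_map; [exact: Jw|move=> ? ? []].
  split; first exact: (h None (mem_head _ _)).
  by move=> i /= iJ; apply: (h (Some i)); rewrite /= inE/= mem_map.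
Qed.

End starting_point.

Section iterates.
Context {R : realType} {n : nat} {d : measure_display} {S : measurableType d}.
Context {d' : measure_display} {Omega : measurableType d'}.
Variables (P : probability S R) (Pr : probability Omega R).
Variables (X A : set 'rV[R]_n) (m : nat).
Variable Fm : 'rV[R]_n -> m.-tuple S -> 'rV[R]_n -> \bar R.
Variables (alpha : nat -> R) (b : nat -> \bar R).
Variables (xi : nat -> 'I_m -> Omega -> S) (x : nat -> Omega -> 'rV[R]_n).
Hypotheses (mX : measurable X) (A0 : A !=set0).
Hypothesis mxi : forall k j, measurable_fun setT (xi k j).
Hypothesis mprox : forall k, measurable_prox X Fm (alpha k).
Hypothesis prox_uniq : forall k y s p q, X y ->
  argmin X (prox_objective Fm (alpha k) y s) p ->
  argmin X (prox_objective Fm (alpha k) y s) q -> p = q.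
Hypothesis contraction : forall k y (T : m.-tuple S -> 'rV[R]_n), X y ->
  measurable_fun setT T ->
  (forall s, argmin X (prox_objective Fm (alpha k) y s) (T s)) ->
  (\int[power_measure P m]_s (dist (T s) A ^+ 2)%:E <=
     expeR (b k) * (dist y A ^+ 2)%:E)%E.
Let V (i : nat * 'I_m) : Omega -> S := xi i.1 i.2.
Hypothesis x0_meas : measurable_fun setT (x 0%N).
Hypothesis x0X : forall w, X (x 0%N w).
Hypothesis x0_indep : independent_outside Pr P V (x 0%N) (fun=> false).
Hypothesis x_iter : prox_iterates X Fm alpha xi x.

Let mV i : measurable_fun setT (V i).
Proof. exact: mxi. Qed.

Let batch k : m.-tuple (nat * 'I_m) := map_tuple (pair k) (ord_tuple m).

Let minibatchE k w : minibatch xi k w = map_tuple (V^~ w) (batch k).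
Proof. by apply: eq_from_tnth => j; rewrite !tnth_map tnth_ord_tuple. Qed.

Let batch_uniq k : uniq (batch k).
Proof. by rewrite map_inj_uniq ?enum_uniq// => ? ? []. Qed.

Let batch_ge k i : i \in batch k -> ~~ (i.1 < k)%N.
Proof. by move=> /mapP[j _ ->] /=; rewrite ltnn. Qed.

Let mdist2 d0 (T0 : measurableType d0) (g : T0 -> 'rV[R]_n) : measurable_fun setT g ->
  measurable_fun setT (fun t => (dist (g t) A ^+ 2)%:E).
Proof.
move=> mg; apply/measurable_EFinP; apply: measurable_funX.
by apply: (measurableT_comp (measurable_dist A0)).
Qed.

Lemma iterates_X k w : X (x k w).
Proof. by case: k => [|k]; [exact: x0X|have [] := x_iter k w]. Qed.

Lemma prox_update k : exists T : 'rV[R]_n * m.-tuple S -> 'rV[R]_n,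
  [/\ measurable_fun setT T,
      forall y s, X y -> argmin X (prox_objective Fm (alpha k) y s) (T (y, s)) &
      forall w, x k.+1 w = T (x k w, minibatch xi k w)].
Proof.
have [T [mT Tmin]] := mprox k.
have Tr y s : X y -> (T \_ (X `*` setT)) (y, s) = T (y, s).
  by move=> Xy; rewrite patchE mem_set.
(* The given update is measurable on [X] only. Its restriction is measurable everywhere and is
   evaluated only at iterates, which stay in [X]. *)
exists (T \_ (X `*` setT)); split.
- by apply/(measurable_restrictT T (measurableX mX measurableT)).
- by move=> y s Xy; rewrite Tr//; exact: Tmin.
- move=> w; have Xw := iterates_X k w; rewrite Tr//.
  exact: (prox_uniq Xw (x_iter k w) (Tmin _ _ Xw)).
Qed.

(** The next iterate is a measurable function of [x k] and batch [k], so absorbing that batch moves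
    the threshold from [k] to [k + 1]. *)
Lemma iterates_independent k : measurable_fun setT (x k) /\
  independent_outside Pr P V (x k) (fun i => (i.1 < k)%N).
Proof.
elim: k => [|k [mk ik]]; first by split => //; exact: independent_outside_sub x0_indep.
have [T [mT Tmin xT]] := prox_update k.
have xE : x k.+1 = T \o (fun w => (x k w, map_tuple (V^~ w) (batch k))).
  by apply/funext => w; rewrite xT minibatchE.
have [ik' _] := independent_outside_tuple mV (U := mfun_Sub (mem_set mk)) ik
  (batch_uniq k) (@batch_ge k).
rewrite xE; split.
  apply: measurableT_comp => //; apply: measurable_fun_pair => //.
  exact: measurable_map_tuple.
have := independent_outside_comp mT ik'; apply: independent_outside_sub => i.
move=> /orP[|/mapP[j _ ->]]/=; first exact: ltnW.
by rewrite ltnSn.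
Qed.

(** Conditioning on the past becomes a Fubini argument: the fresh minibatch is integrated with
    [x k w] frozen, the contraction is applied at that point, and then [w] is integrated. *)
Lemma iterates_step k : (\int[Pr]_w (dist (x k.+1 w) A ^+ 2)%:E <=
  expeR (b k) * \int[Pr]_w (dist (x k w) A ^+ 2)%:E)%E.
Proof.
have [T [mT Tmin xT]] := prox_update k.
have [mk ik] := iterates_independent k.
have [_ fubini] := independent_outside_tuple mV (U := mfun_Sub (mem_set mk)) ik
  (batch_uniq k) (@batch_ge k).
have mdT := mdist2 mT.
have dT0 z : (0 <= (dist (T z) A ^+ 2)%:E)%E by rewrite lee_fin sqr_ge0.
under eq_integral do rewrite xT minibatchE.
rewrite (fubini _ mdT dT0) -ge0_integralZl//; last 3 first.
- exact: mdist2.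
- by move=> w _; rewrite lee_fin sqr_ge0.
- exact: expeR_ge0.
apply: ge0_le_integral => //.
- by move=> w _; apply: integral_ge0 => s _.
- exact: (measurableT_comp (measurable_fun_fubini_tonelli_F
    (m2 := power_measure P m) _ mdT dT0) mk).
- by apply: measurable_funeM; exact: mdist2.
move=> w _; apply: contraction; first exact: iterates_X.
- exact: (measurableT_comp mT (measurable_pair1 _)).
- by move=> s; apply: Tmin; exact: iterates_X.
Qed.

Lemma iterates_bound k : ('E_Pr[fun w => (dist (x k w) A ^+ 2)%R] <=
  expeR (\sum_(i < k) b i) * 'E_Pr[fun w => (dist (x 0%N w) A ^+ 2)%R])%E.
Proof.
rewrite unlock; elim: k => [|k IHk]; first by rewrite big_ord0 expeR0 mul1e.
rewrite big_ord_recr/= addeC expeRD -muleA.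
apply: le_trans (iterates_step k) _.
by apply: lee_wpmul2l => //; exact: expeR_ge0.
Qed.

End iterates.

(** * The constant stepsize and the final rates *)

Lemma constant_step_rate (R : realFieldType) (L lambda V eta rho : R) :
  0 < lambda -> lambda <= L -> 0 <= V -> eta = Num.max L (8 * V / lambda) ->
  rho <= lambda / (8 * L) -> (V != 0 -> rho <= lambda ^+ 2 / (64 * V)) ->
  - (2^-1 * (lambda * (L + eta)^-1)) + V * ((L + eta)^-1 / eta) <= - rho.
Proof.
move=> l0 lL V0 etaE rhoL rhoV.
have L0 : 0 < L := lt_le_trans l0 lL.
have Leta : L <= eta by rewrite etaE le_max lexx.
have eta0 : 0 < eta := lt_le_trans L0 Leta.
(* With [a = (L + eta)^-1], the noise term is thus at most [lambda a / 8], leaving a decrease of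
   [3 lambda a / 8]. Since [eta >= L], this is at least [lambda / (8 eta)]. *)
have Veta : V / eta <= lambda / 8.
  have : 8 * V / lambda <= eta by rewrite etaE le_max lexx orbT.
  by rewrite !ler_pdivrMr//; lra.
have rho_eta : rho <= lambda / (8 * eta).
  (* Each branch of the maximum matches one entry of the minimum: [eta = L] gives [lambda / (8 L)],
     and [eta = 8 V / lambda] gives [lambda^2 / (64 V)]. *)
  move: etaE; rewrite /Num.max; case: ifP => [LV etaE|_ ->//].
  have Vn0 : V != 0.
    by apply/eqP => V00; move: LV; rewrite V00 mulr0 mul0r ltNge (ltW L0).
  apply: le_trans (rhoV Vn0) _; rewrite etaE le_eqVlt; apply/orP; left.
  by apply/eqP; field; rewrite Vn0 gt_eqF.
have a0 : 0 < (L + eta)^-1 by rewrite invr_gt0 addr_gt0.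
have aeta : (2 * eta)^-1 <= (L + eta)^-1.
  by rewrite lef_pV2 ?posrE ?addr_gt0 ?mulr_gt0//; lra.
have h1 : V * ((L + eta)^-1 / eta) <= (L + eta)^-1 * (lambda / 8).
  by rewrite mulrCA ler_pM2l.
have h2 : lambda * (2 * eta)^-1 <= lambda * (L + eta)^-1 by rewrite ler_pM2l.
have h3 : lambda / (8 * eta) = lambda * (2 * eta)^-1 / 4 by field; rewrite gt_eqF.
have h4 : 0 < lambda * (L + eta)^-1 by rewrite mulr_gt0.
lra.
Qed.

Theorem theorem3 (R : realType) (n : nat)
  (d : measure_display) (S : measurableType d) (P : probability S R)
  (* the problem *)
  (X : set 'rV[R]_n) (F : 'rV[R]_n -> S -> \bar R)
  (X_closed : closed X)
  (X_convex : convex_set X)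
  (F_proper : forall x s, F x s != -oo%E)
  (F_closed : forall s, closed_function (F^~ s))
  (F_convex : forall s, convex_on setT (F^~ s))
  (F_subdiff : forall s, subdifferentiable_on X (F^~ s))
  (F_integrable : forall x, X x -> P.-integrable setT (F x))
  (* interpolation *)
  (xstar : 'rV[R]_n)
  (xstar_min : argmin X (objective P F) xstar)
  (interpolation : {ae P, forall s, ereal_inf [set F x s | x in X] = F xstar s})
  (* gradient of the objective, and its Lipschitz continuity *)
  (gradf : 'rV[R]_n -> 'rV[R]_n)
  (gradf_gradient : forall x, X x ->
    is_gradient_on X (fun y => fine (objective P F y)) x (gradf x))
  (gradf_unbiased : forall x, X x ->
    forall G, subgradient_selection F x G ->
    forall i, ('E_P[fun s => (G s 0 i)%R] = (gradf x 0 i)%R%:E)%E)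
  (L lambda sigma : R)
  (gradf_Lipschitz : forall x y, X x -> X y ->
    enorm (gradf x - gradf y) <= L * enorm (x - y))
  (* quadratic growth and noise bound *)
  (lambda_gt0 : 0 < lambda)
  (growth : forall x, X x ->
    ((lambda * dist x (argmin X (objective P F)) ^+ 2)%R%:E
       <= objective P F x - objective P F xstar)%E)
  (noise : forall x, X x ->
    forall G, subgradient_selection F x G ->
    ('E_P[fun s => (enorm (gradf x - G s) ^+ 2)%R]
       <= (sigma ^+ 2 * dist x (argmin X (objective P F)) ^+ 2)%R%:E)%E)
  (lambda_le_L : lambda <= L)
  (* models of the average *)
  (m : nat) (m_ge1 : (1 <= m)%N)
  (Fm : 'rV[R]_n -> m.-tuple S -> 'rV[R]_n -> \bar R)
  (Fm_convex : forall x s, X x -> convex_on X (Fm x s))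
  (Fm_subdiff : forall x s, X x -> subdifferentiable_on X (Fm x s))
  (Fm_below : forall x s y, X x -> X y -> (Fm x s y <= sample_average F s y)%E)
  (Fm_exact : forall x s, X x -> Fm x s x = sample_average F s x)
  (Fm_subgrad : forall x s, X x ->
    subdiff (Fm x s) x `<=` subdiff (sample_average F s) x)
  (average_subgrad : forall x (g : m.-tuple S -> 'rV[R]_n), X x ->
    (forall s, subdiff (sample_average F s) x (g s)) ->
    exists2 G : S -> 'rV[R]_n, subgradient_selection F x G &
      {ae power_measure P m, forall s : m.-tuple S,
         g s = m%:R^-1 *: \sum_(j < m) G (tnth s j)})
  (* the samples *)
  (d' : measure_display) (Omega : measurableType d') (Pr : probability Omega R)
  (xi : nat -> 'I_m -> Omega -> S)
  (xi_iid : iid_samples Pr P xi) :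
  (* (i) *)
  (forall (eta alpha : nat -> R) (x0 : 'rV[R]_n) (x : nat -> Omega -> 'rV[R]_n),
     (forall i, 0 <= eta i) ->
     (forall i, alpha i = (L + eta i)^-1) ->
     (forall i, measurable_prox X Fm (alpha i)) ->
     X x0 ->
     (forall w, x 0%N w = x0) ->
     prox_iterates X Fm alpha xi x ->
     forall k, (1 <= k)%N ->
     ('E_Pr[fun w => (dist (x k w) (argmin X (objective P F)) ^+ 2)%R]
        <= expeR (- (2^-1 * \sum_(i < k) lambda * alpha i)%R%:E
                  + \sum_(i < k) (if eta i == 0%R then +oo
                      else (sigma ^+ 2 / m%:R * (alpha i / eta i))%R%:E))
           * (dist x0 (argmin X (objective P F)) ^+ 2)%R%:E)%E)
  /\
  (* (ii) *)
  (forall (eta : R) (alpha : nat -> R) (x : nat -> Omega -> 'rV[R]_n),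
     eta = Num.max L (8 * sigma ^+ 2 / (m%:R * lambda)) ->
     (forall i, alpha i = (L + eta)^-1) ->
     (forall i, measurable_prox X Fm (alpha i)) ->
     measurable_fun setT (x 0%N) ->
     (forall w, X (x 0%N w)) ->
     start_independent Pr (x 0%N) xi ->
     prox_iterates X Fm alpha xi x ->
     forall k, (1 <= k)%N ->
     ('E_Pr[fun w => (dist (x k w) (argmin X (objective P F)) ^+ 2)%R]
        <= expeR (- (k%:R%R%:E
                     * Order.min (lambda / (8 * L))%R%:E
                         (if sigma == 0%R then +oo
                          else (m%:R * lambda ^+ 2 / (64 * sigma ^+ 2))%R%:E)))
           * 'E_Pr[fun w =>
               (dist (x 0%N w) (argmin X (objective P F)) ^+ 2)%R])%E).
Proof.
have L_gt0 : 0 < L := lt_le_trans lambda_gt0 lambda_le_L.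
have Xs0 : argmin X (objective P F) !=set0 by exists xstar.
have mX := closed_measurable_rV X_closed.
have [mxi xi_law xi_indep] := xi_iid.
have prox_uniq a : 0 < a -> forall y s p q, X y ->
    argmin X (prox_objective Fm a y s) p ->
    argmin X (prox_objective Fm a y s) q -> p = q.
  move=> a0 y s p q Xy.
  have c0 : 0 < (2 * a)^-1 by rewrite invr_gt0 mulr_gt0.
  have Mfin z : X z -> Fm y s z \is a fin_num :=
    subdifferentiable_fin (Fm_subdiff y s Xy).
  exact: (prox_unique X_convex (Fm_convex y s Xy) Mfin c0).
split.
  move=> eta alpha x0 x eta0 alphaE mprox Xx0 x0E xit k _.
  have x0E' : x 0%N = fun=> x0 by apply/funext.
  (* The exponents are extended reals, so that a step with [eta i = 0] is covered by the value
     [+oo]. *)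
  pose b i := ((- (2^-1 * (lambda * alpha i)))%:E + if eta i == 0%R then +oo
      else (sigma ^+ 2 / m%:R * (alpha i / eta i))%:E)%E.
  have alpha_gt0 i : 0 < alpha i.
    by rewrite alphaE invr_gt0 ltr_wpDr.
  have := @iterates_bound R n d S d' Omega P Pr X (argmin X (objective P F)) m Fm
    alpha b xi x mX Xs0 mxi mprox (fun i => prox_uniq _ (alpha_gt0 i)) _ _ _ _ xit k.
  rewrite x0E' (expectation_cst Pr) /b big_split/=.
  rewrite sumEFin sumrN -mulr_sumr.
  apply.
  - move=> i y T Xy mT; rewrite /= alphaE => Tmin.
    exact: (one_step_contraction X_convex F_subdiff F_integrable xstar_min
      gradf_unbiased gradf_Lipschitz lambda_gt0 growth noise lambda_le_L m_ge1
      Fm_convex Fm_subdiff Fm_below Fm_exact Fm_subgrad average_subgrad).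
  - exact: measurable_cst.
  - by [].
  - apply: independent_outside_cst => //; by move=> i; exact: xi_law.
move=> eta alpha x etaE alphaE mprox mx0 x0X x0_indep xit k _.
have m0 : 0 < m%:R :> R by rewrite ltr0n.
have eta_gt0 : 0 < eta by rewrite etaE lt_max L_gt0.
have alpha_gt0 i : 0 < alpha i by rewrite alphaE invr_gt0 addr_gt0.
(* The minimum is real because its first entry is. The convention [+oo] at [sigma = 0] becomes a
   bound on [rho] required only for nonzero [sigma ^+ 2 / m%:R]. *)
have [rho [rhoE rhoL rhoV]] : exists rho,
    [/\ Order.min (lambda / (8 * L))%:E (if sigma == 0%R then +oo
          else (m%:R * lambda ^+ 2 / (64 * sigma ^+ 2))%:E)%E = rho%:E,
        rho <= lambda / (8 * L) &
        sigma ^+ 2 / m%:R != 0 -> rho <= lambda ^+ 2 / (64 * (sigma ^+ 2 / m%:R))].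
  have [s0|s0] := eqVneq sigma 0.
    exists (lambda / (8 * L)); split => //; first by rewrite min_l// leey.
    by rewrite s0 expr0n mul0r eqxx.
  exists (Num.min (lambda / (8 * L)) (m%:R * lambda ^+ 2 / (64 * sigma ^+ 2))).
  split; [by rewrite EFin_min|by rewrite ge_min lexx|move=> _].
  have -> : lambda ^+ 2 / (64 * (sigma ^+ 2 / m%:R)) = m%:R * lambda ^+ 2 / (64 * sigma ^+ 2).
    by field; rewrite s0 gt_eqF.
  by rewrite ge_min lexx orbT.
have sumE : (\sum_(i < k) (- rho)%:E = - (k%:R%R%:E * rho%:E))%E.
  rewrite sumEFin sumr_const card_ord -[- rho *+ k]mulr_natl mulrN EFinN EFinM.
  reflexivity.
have := @iterates_bound R n d S d' Omega P Pr X (argmin X (objective P F)) m Fm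
  alpha (fun=> (- rho)%:E) xi x mX Xs0 mxi mprox
  (fun i => prox_uniq _ (alpha_gt0 i)) _ mx0 x0X _ xit k.
rewrite rhoE sumE; apply.
- move=> i y T Xy mT; rewrite alphaE => Tmin.
  apply: le_trans (one_step_contraction_gt0 X_convex F_subdiff F_integrable xstar_min
      gradf_unbiased gradf_Lipschitz lambda_gt0 growth noise lambda_le_L m_ge1
      Fm_convex Fm_subdiff Fm_below Fm_exact Fm_subgrad average_subgrad
      Xy eta_gt0 mT Tmin) _.
  rewrite /= lee_fin ler_wpM2r ?sqr_ge0// ler_expR.
  apply: (constant_step_rate lambda_gt0 lambda_le_L) => //.
    by rewrite divr_ge0// sqr_ge0.
  rewrite etaE; congr Num.max; by field; rewrite !gt_eqF.
- by apply: independent_outside_start => // i; exact: xi_law.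
Qed.
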